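(* Let $k$ be a field of characteristic $p>0$, let $R=k[x_1,\dots,x_n]$ be the polynomial ring in $n$ variables over $k$, and let $I=(f_1,\dots,f_s)$ be an ideal of $R$ generated by polynomials $f_1,\dots,f_s\in R$ such that $\sum_{j=1}^{s}\deg f_j<n$. Let $i\geq 0$ be an integer. If $P$ is an associated prime of the local cohomology module $H^i_I(R)$, then $$\dim R/P\;\geq\; n-\sum_{j=1}^{s}\deg f_j.$$
   Context: $\deg$ denotes the total degree of a polynomial; the $f_j$ are not assumed homogeneous. $H^i_I(R)$ is the $i$-th local cohomology module of $R$ with support in $I$, and $\dim$ is Krull dimension. *)

(* Defs.v *)
From HB Require Import structures.
From mathcomp Require Import all_boot all_order all_algebra.
From mathcomp Require Import ring_quotient boolp mpoly.

Set Implicit Arguments.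
Unset Strict Implicit.
Unset Printing Implicit Defensive.

Import GRing.Theory.
Local Open Scope ring_scope.
Local Open Scope quotient_scope.

(* The total degree; msize is the degree plus one, and the zero polynomial
   gets degree 0. *)
Definition tdeg (k : fieldType) (n : nat) (f : {mpoly k[n]}) : nat :=
  (msize f).-1.

Section Ideals.
Variable R : comNzRingType.

Definition ideal_gen (s : nat) (f : 'I_s -> R) : {pred R} :=
  fun r => `[< exists c : 'I_s -> R, r = \sum_j c j * f j >].

Definition ideal_exp (I : {pred R}) (t : nat) : {pred R} :=
  fun r => `[< exists (m : nat) (c : 'I_m -> R) (a : 'I_m -> 'I_t -> R),
    (forall i j, a i j \in I) /\ r = \sum_i c i * \prod_j a i j >].

(* The supremum of the lengths l of strictly increasing chains
   Q_0 < ... < Q_l of prime ideals is at least d. *)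
Definition krull_dim_ge (d : nat) : Prop :=
  exists2 l : nat, (d <= l)%N &
    exists Q : 'I_l.+1 -> prime_idealr R,
      forall i j : 'I_l.+1, (i < j)%N ->
        {subset Q i <= Q j} /\ ~ {subset Q j <= Q i}.

Definition associated_prime (M : lmodType R) (P : prime_idealr R) : Prop :=
  exists z : M, forall r : R, (r \in P) = (r *: z == 0).

Definition injective_module (E : lmodType R) : Prop :=
  forall (A B : lmodType R) (u : {linear A -> B}) (g : {linear A -> E}),
    injective u -> exists h : {linear B -> E}, forall a, h (u a) = g a.

End Ideals.

Section SubQuotientModules.
Variables (R : comNzRingType) (V : lmodType R) (N : submodClosed V).

Definition submod := {x : V | x \in N}.
HB.instance Definition _ := SubChoice.on submod.
HB.instance Definition _ := [SubChoice_isSubLmodule of submod by <:].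

(* A submodClosed predicate carries no closure under opposites, which the
   quotient of the underlying group asks for. *)
Definition submod_zmod : {pred V} := fun x => x \in N.
Lemma submod_zmod_closed : zmod_closed submod_zmod.
Proof. exact: GRing.submod_closedB (submodClosedP N). Qed.
HB.instance Definition _ :=
  GRing.isZmodClosed.Build V submod_zmod submod_zmod_closed.

Definition quotmod := Quotient.quot submod_zmod.
HB.instance Definition _ := GRing.Zmodule.on quotmod.

Definition quotmod_scale (a : R) (x : quotmod) : quotmod :=
  \pi_(Quotient.quot submod_zmod) (a *: repr (x : (Quotient.quot submod_zmod))).

Lemma quotmod_scale_pi a (x : V) :
  quotmod_scale a (\pi_(Quotient.quot submod_zmod) x) = \pi_(Quotient.quot submod_zmod) (a *: x).
Proof.
apply/eqP; rewrite /quotmod_scale -Quotient.idealrBE -scalerBr.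
have hx : repr (\pi_(Quotient.quot submod_zmod) x) - x \in submod_zmod.
  by rewrite Quotient.idealrBE reprK.
exact: (rpredZ (s := N) a hx).
Qed.

Lemma quotmod_scaleA a b x :
  quotmod_scale a (quotmod_scale b x) = quotmod_scale (a * b) x.
Proof. by rewrite -[x](@reprK _ (Quotient.quot submod_zmod)) !quotmod_scale_pi scalerA. Qed.

Lemma quotmod_scale1 : left_id 1 quotmod_scale.
Proof. by move=> x; rewrite -[x](@reprK _ (Quotient.quot submod_zmod)) quotmod_scale_pi scale1r. Qed.

Lemma quotmod_scaleDr : right_distributive quotmod_scale +%R.
Proof.
move=> a x y; rewrite -[x](@reprK _ (Quotient.quot submod_zmod)) -[y](@reprK _ (Quotient.quot submod_zmod)).
by rewrite -raddfD !quotmod_scale_pi scalerDr raddfD.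
Qed.

Lemma quotmod_scaleDl x : {morph quotmod_scale^~ x : a b / a + b}.
Proof.
move=> a b; rewrite -[x](@reprK _ (Quotient.quot submod_zmod)) !quotmod_scale_pi.
by rewrite scalerDl raddfD.
Qed.

HB.instance Definition _ := GRing.Zmodule_isLmodule.Build R quotmod
  quotmod_scaleA quotmod_scale1 quotmod_scaleDr quotmod_scaleDl.

End SubQuotientModules.

Section Complexes.
Variable R : comNzRingType.

Record cochain_complex := CochainComplex {
  cobj :> nat -> lmodType R;
  cdiff : forall q, {linear cobj q -> cobj q.+1};
  cdiffK : forall q x, cdiff q.+1 (cdiff q x) = 0
}.

Section Cohomology.
Variable C : cochain_complex.

Definition cocycle (q : nat) : {pred C q} := fun x => cdiff C q x == 0.

Lemma cocycle_closed q : subsemimod_closed (@cocycle q).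
Proof.
split; first split; rewrite ?unfold_in ?raddf0 //.
- by move=> x y /eqP hx /eqP hy; rewrite unfold_in raddfD /= hx hy addr0.
- by move=> a x /eqP hx; rewrite unfold_in linearZ /= hx scaler0.
Qed.
HB.instance Definition _ q :=
  GRing.isSubmodClosed.Build R (C q) (@cocycle q) (@cocycle_closed q).

Definition cocycles (q : nat) : lmodType R := submod (@cocycle q).

Definition coboundary (q : nat) : {pred cocycles q} :=
  match q return {pred cocycles q} with
  | 0 => fun z => z == 0
  | q'.+1 => fun z => `[< exists y : C q', val z = cdiff C q' y >]
  end.

Lemma coboundary_closed q : subsemimod_closed (@coboundary q).
Proof.
case: q => [|q]; (split; first split); rewrite ?unfold_in ?eqxx //=.
- by move=> x y /eqP -> /eqP ->; rewrite unfold_in addr0.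
- by move=> a x /eqP ->; rewrite unfold_in scaler0.
- by apply/asboolP; exists 0; rewrite !raddf0.
- move=> x y /asboolP[x' hx] /asboolP[y' hy]; apply/asboolP.
  by exists (x' + y'); rewrite !raddfD /= hx hy.
- move=> a x /asboolP[x' hx]; apply/asboolP.
  by exists (a *: x'); rewrite !linearZ /= hx.
Qed.
HB.instance Definition _ q :=
  GRing.isSubmodClosed.Build R (cocycles q) (@coboundary q)
    (@coboundary_closed q).

Definition cohomology (q : nat) : lmodType R := quotmod (@coboundary q).

End Cohomology.

Record injective_resolution (M : lmodType R) := InjectiveResolution {
  ires :> cochain_complex;
  ires_aug : {linear M -> ires 0%N};
  ires_inj : forall q, injective_module (ires q);
  ires_aug_inj : injective ires_aug;
  ires_exact0 : forall x,
    cdiff ires 0 x = 0 <-> exists m, x = ires_aug m;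
  ires_exactS : forall q x,
    cdiff ires q.+1 x = 0 <-> exists y, x = cdiff ires q y
}.

End Complexes.

Section LocalCohomology.
Variables (R : comNzRingType) (I : {pred R}).

Definition torsion (M : lmodType R) : {pred M} :=
  fun x => `[< exists t, forall r, r \in ideal_exp I t -> r *: x = 0 >].

Lemma ideal_exp_leq t u r :
  (t <= u)%N -> r \in ideal_exp I u -> r \in ideal_exp I t.
Proof.
move=> le_tu /asboolP[m [c [a [Ia ->]]]]; apply/asboolP.
pose g (j : 'I_(t + (u - t))) : 'I_u := cast_ord (subnKC le_tu) j.
exists m, (fun i => c i * \prod_(j < u - t) a i (g (rshift t j))),
  (fun i j => a i (g (lshift (u - t) j))); split=> [i j|]; first exact: Ia.
apply: eq_bigr => i _; rewrite -mulrA; congr (_ * _).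
rewrite mulrC -(big_split_ord (GRing.mul) xpredT (fun j => a i (g j))).
by rewrite (reindex g) //; exists (cast_ord (esym (subnKC le_tu))) => j _;
  apply: val_inj.
Qed.

Lemma torsion_closed M : subsemimod_closed (@torsion M).
Proof.
split; first split.
- by apply/asboolP; exists 0%N => r _; rewrite scaler0.
- move=> x y /asboolP[t ht] /asboolP[u hu]; apply/asboolP.
  exists (maxn t u) => r hr; rewrite scalerDr ht ?hu ?addr0 //.
    exact: ideal_exp_leq (leq_maxr t u) hr.
  exact: ideal_exp_leq (leq_maxl t u) hr.
- move=> a x /asboolP[t ht]; apply/asboolP; exists t => r hr.
  by rewrite scalerA mulrC -scalerA ht // scaler0.
Qed.
HB.instance Definition _ M :=
  GRing.isSubmodClosed.Build R M (@torsion M) (@torsion_closed M).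

Definition Gamma (M : lmodType R) : lmodType R := submod (@torsion M).

Section GammaMap.
Variables (M N : lmodType R) (u : {linear M -> N}).

Lemma Gamma_map_subproof (x : Gamma M) : u (val x) \in @torsion N.
Proof.
have /asboolP[t ht] := valP x; apply/asboolP; exists t => r hr.
by rewrite -linearZ /= ht // raddf0.
Qed.

Definition Gamma_map (x : Gamma M) : Gamma N :=
  (exist _ (u (val x)) (Gamma_map_subproof x) : submod (@torsion N)).

Lemma Gamma_map_linear : linear Gamma_map.
Proof. by move=> a x y; apply: val_inj; rewrite /= linearP. Qed.
HB.instance Definition _ :=
  GRing.isLinear.Build R (Gamma M) (Gamma N) *:%R Gamma_map Gamma_map_linear.

End GammaMap.

Section GammaComplex.
Variable C : cochain_complex R.

Lemma Gamma_diffK q (x : Gamma (C q)) :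
  Gamma_map (cdiff C q.+1) (Gamma_map (cdiff C q) x) = 0.
Proof. by apply: val_inj; rewrite /= cdiffK. Qed.

Definition Gamma_complex : cochain_complex R :=
  @CochainComplex R (fun q => Gamma (C q))
    (fun q => Gamma_map (cdiff C q)) Gamma_diffK.

End GammaComplex.

(* H^i_I(M), the i-th right derived functor of Gamma_I at M, computed from the
   injective resolution E of M; up to isomorphism it does not depend on E. *)
Definition local_cohomology (M : lmodType R) (E : injective_resolution M)
  (i : nat) : lmodType R := cohomology (Gamma_complex E) i.

End LocalCohomology.

(* Main.v *)
(* A class z of H^i_I(R) is represented by a Koszul cocycle on f_1^t, ..., f_s^t,
   hence, after multiplication by products of the f_j^(q-t), by a Koszul cocycle
   zeta on the f_j^q for every large q = p^e; its entries have degree at most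
   q * d + O(1), where d is the sum of the deg f_j.  Let P be the annihilator of z
   and x_U a maximal set of variables with P /\ k[x_U] = 0.  The Koszul
   differential is linear over A = k[x_U][x_i^q : i notin U], and R is free over
   A on the monomials x^a with a_i < q, so that zeta splits into cocycles zeta_a
   over A, where zeta_a = 0 as soon as |a| > q * d + O(1).  Each i notin U yields
   an element h_i of P of fixed degree r_i in x_i with coefficients in k[x_U], and
   comparing coefficients in h_i * zeta, which is a coboundary, shows that zeta_a
   is a coboundary up to k[x_U]-torsion, by descending induction on |a|, unless
   a_i >= q - r_i for all i notin U.  If n - #|U| > d, no such a has
   |a| <= q * d + O(1) for q large; then a nonzero element of k[x_U] kills z, a
   contradiction.  So #|U| >= n - d, and an integrality argument in the style of
   Zariski's lemma yields a chain of primes of length #|U| above P. *)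

Require Import Defs.
From HB Require Import structures.
From mathcomp Require Import all_boot all_order all_algebra.
From mathcomp Require Import ring_quotient boolp mpoly ring.
From mathcomp Require classical_sets.

Set Implicit Arguments.
Unset Strict Implicit.
Unset Printing Implicit Defensive.

Import Order.TTheory GRing.Theory.
Local Open Scope ring_scope.
Local Open Scope quotient_scope.

(** * Koszul cochains *)

Section Koszul.
Variable R : comNzRingType.
Implicit Types (fs : seq R) (M N : lmodType R) (t u j : nat).

(* Koszul cochains as iterated mapping cones: the type does not depend on the
   exponent t of the sequence f_1^t, ..., f_s^t, only the differential does. *)
Fixpoint kos fs M : lmodType R :=
  if fs is _ :: fs' then (kos fs' M * kos fs' M)%type : lmodType R else M.

(** The differential of the cone of multiplication by [f ^+ t], with the second component shifted by
    one degree; the minus sign makes it square to zero. *)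
Fixpoint kdiff t fs M : kos fs M -> kos fs M :=
  match fs return kos fs M -> kos fs M with
  | [::] => fun _ => 0
  | f :: fs' => fun y => (kdiff t y.1, f ^+ t *: y.1 - kdiff t y.2)
  end.

(* The transition map from exponent t to exponent t + u. *)
Fixpoint ktrans u fs M : kos fs M -> kos fs M :=
  match fs return kos fs M -> kos fs M with
  | [::] => id
  | f :: fs' => fun y => (ktrans u y.1, f ^+ u *: ktrans u y.2)
  end.

Fixpoint kmap fs M N (h : M -> N) : kos fs M -> kos fs N :=
  match fs return kos fs M -> kos fs N with
  | [::] => h
  | f :: fs' => fun y => (kmap h y.1, kmap h y.2)
  end.

Fixpoint kinc fs M (x : M) : kos fs M :=
  match fs return kos fs M with
  | [::] => x
  | f :: fs' => (kinc fs' x, 0)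
  end.

(* Homogeneity in cohomological degree j, the grading not being part of the type. *)
Fixpoint khom j fs M : kos fs M -> Prop :=
  match fs return kos fs M -> Prop with
  | [::] => fun y => if j is 0 then True else y = 0
  | f :: fs' => fun y =>
    khom j y.1 /\ if j is j'.+1 then khom j' y.2 else y.2 = 0
  end.

Fixpoint kall fs M (p : M -> Prop) : kos fs M -> Prop :=
  match fs return kos fs M -> Prop with
  | [::] => p
  | f :: fs' => fun y => kall p y.1 /\ kall p y.2
  end.

Lemma kdiff_linear t fs M : linear (@kdiff t fs M).
Proof.
elim: fs => [|f fs IH] a x y /=; first by rewrite scaler0 addr0.
congr (_, _) => /=; first exact: IH.
by rewrite IH scalerDr scalerBr !scalerA [a * _]mulrC opprD addrACA.
Qed.
HB.instance Definition _ t fs M :=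
  GRing.isLinear.Build R (kos fs M) (kos fs M) _ (@kdiff t fs M)
    (@kdiff_linear t fs M).

Lemma kdiffD t fs M (x y : kos fs M) : kdiff t (x + y) = kdiff t x + kdiff t y.
Proof. exact: linearD. Qed.

Lemma ktrans_linear u fs M : linear (@ktrans u fs M).
Proof.
elim: fs => [|f fs IH] a x y //=.
by congr (_, _) => /=; rewrite IH // scalerDr !scalerA mulrC.
Qed.
HB.instance Definition _ u fs M :=
  GRing.isLinear.Build R (kos fs M) (kos fs M) _ (@ktrans u fs M)
    (@ktrans_linear u fs M).

Lemma ktransD u fs M (x y : kos fs M) :
  ktrans u (x + y) = ktrans u x + ktrans u y.
Proof. exact: linearD. Qed.

Lemma kmap_linear fs M N (h : {linear M -> N}) : linear (@kmap fs M N h).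
Proof.
by elim: fs => [|f fs IH] a x y /=; rewrite ?linearP //; congr (_, _); apply: IH.
Qed.
HB.instance Definition _ fs M N (h : {linear M -> N}) :=
  GRing.isLinear.Build R (kos fs M) (kos fs N) _ (@kmap fs M N h)
    (@kmap_linear fs M N h).

Lemma kdiffK t fs M (y : kos fs M) : kdiff t (kdiff t y) = 0.
Proof.
elim: fs y => [|f fs IH] y //=.
by rewrite !raddfB /= !IH linearZ /= oppr0 subr0 subrr.
Qed.

Lemma kdiff_trans t u fs M (y : kos fs M) :
  kdiff (t + u) (ktrans u y) = ktrans u (kdiff t y).
Proof.
elim: fs y => [|f fs IH] y //=.
rewrite !IH raddfB /= !linearZ /= IH scalerBr scalerA exprD.
by rewrite scalerN [f ^+ u * _]mulrC.
Qed.

Lemma ktrans_comp t u fs M (y : kos fs M) :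
  ktrans u (ktrans t y) = ktrans (t + u) y.
Proof.
elim: fs y => [|f fs IH] y //=.
by rewrite linearZ /= !IH scalerA exprD mulrC.
Qed.

Lemma kmap_diff t fs M N (h : {linear M -> N}) (y : kos fs M) :
  kmap h (kdiff t y) = kdiff t (kmap h y).
Proof.
elim: fs y => [|f fs IH] y /=; first exact: raddf0.
by rewrite raddfB /= linearZ /= !IH.
Qed.

Lemma kmap_trans u fs M N (h : {linear M -> N}) (y : kos fs M) :
  kmap h (ktrans u y) = ktrans u (kmap h y).
Proof. by elim: fs y => [|f fs IH] y //=; rewrite linearZ /= !IH. Qed.

Lemma kmap_comp fs M N N' (h : M -> N) (g : N -> N') (y : kos fs M) :
  kmap g (kmap h y) = kmap (g \o h) y.
Proof. by elim: fs y => [|f fs IH] y //=; rewrite !IH. Qed.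

Lemma kmap_eq0 fs M N (h : M -> N) : (forall x, h x = 0) ->
  forall y : kos fs M, kmap h y = 0.
Proof. by move=> h0; elim: fs => [|f fs IH] y //=; rewrite !IH. Qed.

Lemma kmap_inj fs M N (h : M -> N) : injective h -> injective (@kmap fs M N h).
Proof.
by move=> hi; elim: fs => [|f fs IH] //= [a b] [c d] /= [/IH -> /IH ->].
Qed.

Lemma khom0 j fs M : khom j (0 : kos fs M).
Proof. by elim: fs j => [|f fs IH] [|j] //=; split. Qed.

Lemma khomP j fs M a (x y : kos fs M) :
  khom j x -> khom j y -> khom j (a *: x + y).
Proof.
elim: fs j x y => [|f fs IH] [|j] x y //=.
- by move=> -> ->; rewrite scaler0 addr0.
- by move=> [? ->] [? ->]; split; [apply: IH | rewrite scaler0 addr0].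
- by move=> [? ?] [? ?]; split; apply: IH.
Qed.

Lemma khomZ j fs M a (x : kos fs M) : khom j x -> khom j (a *: x).
Proof. by move=> hx; rewrite -[_ *: _]addr0; apply: khomP => //; apply: khom0. Qed.

Lemma khomD j fs M (x y : kos fs M) : khom j x -> khom j y -> khom j (x + y).
Proof. by move=> hx hy; rewrite -[x]scale1r; apply: khomP. Qed.

Lemma khomB j fs M (x y : kos fs M) : khom j x -> khom j y -> khom j (x - y).
Proof. by move=> hx hy; rewrite addrC -scaleN1r; apply: khomP. Qed.

Lemma khom_diff t j fs M (y : kos fs M) : khom j y -> khom j.+1 (kdiff t y).
Proof.
elim: fs j y => [|f fs IH] j y //= [h1 h2]; split; first exact: IH.
case: j h1 h2 => [|j] h1 h2; last by apply: khomB; [apply: khomZ | apply: IH].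
by rewrite h2 linear0 subr0; apply: khomZ.
Qed.

Lemma khom_trans u j fs M (y : kos fs M) : khom j y -> khom j (ktrans u y).
Proof.
elim: fs j y => [|f fs IH] j y //= [h1 h2]; split; first exact: IH.
by case: j h1 h2 => [|j] h1 h2; [rewrite h2 linear0 scaler0 | apply/khomZ/IH].
Qed.

Lemma khom_map j fs M N (h : M -> N) (y : kos fs M) : h 0 = 0 ->
  khom j y -> khom j (kmap h y).
Proof.
move=> h0; have k0 gs : kmap h (0 : kos gs M) = 0.
  by elim: gs => [|f gs IH] //=; rewrite IH.
elim: fs j y => [|f fs IH] [|j] y //=; first by move=> ->.
  by move=> [h1 ->]; split; [apply: IH|].
by move=> [h1 h2]; split; apply: IH.
Qed.

Lemma kinc_hom fs M (x : M) : khom 0 (kinc fs x).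
Proof. by elim: fs => [|f fs IH]. Qed.

Lemma khom0_inc fs M (y : kos fs M) : khom 0 y -> exists x, y = kinc fs x.
Proof.
elim: fs y => [|f fs IH] y /=; first by exists y.
by case: y => a b /= [/IH[x ->] ->]; exists x.
Qed.

Lemma kinc_inj fs M : injective (@kinc fs M).
Proof. by elim: fs => [|f fs IH] x y //= [] /IH. Qed.

Lemma kinc_linear fs M : linear (@kinc fs M).
Proof.
elim: fs => [|f fs IH] a x y //=.
by rewrite IH; congr (_, _); rewrite /= scaler0 addr0.
Qed.
HB.instance Definition _ fs M :=
  GRing.isLinear.Build R M (kos fs M) _ (@kinc fs M) (@kinc_linear fs M).

Lemma kmap_inc fs M N (h : {linear M -> N}) (x : M) :
  kmap h (kinc fs x) = kinc fs (h x).
Proof. by elim: fs => [|f fs IH] //=; rewrite IH linear0. Qed.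

Lemma ktrans_inc u fs M (x : M) : ktrans u (kinc fs x) = kinc fs x.
Proof. by elim: fs => [|f fs IH] //=; rewrite IH linear0 scaler0. Qed.

Lemma kdiff_inc t fs M (x : M) :
  kdiff t (kinc fs x) = 0 <-> forall f, f \in fs -> f ^+ t *: x = 0.
Proof.
elim: fs => [|f fs IH] /=; first by split.
rewrite linear0 subr0 -linearZ; split=> [[/IH h1 h2] g|h].
  rewrite inE => /orP[/eqP ->|/h1 //].
  by apply: (@kinc_inj fs); rewrite h2 linear0.
congr (_, _); first by apply/IH => g hg; apply: h; rewrite inE hg orbT.
by rewrite h ?linear0 // inE eqxx.
Qed.

(** Entries are lifted one at a time; those outside degree [j] vanish and are lifted to zero, so
    that homogeneity survives. *)
Lemma kmap_lift fs j M N (h : M -> N) (p : N -> Prop) (y : kos fs N) :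
  h 0 = 0 -> (forall x, p x -> exists x', x = h x') ->
  kall p y -> khom j y -> exists2 y', khom j y' & y = kmap h y'.
Proof.
move=> h0 lift; have k0 gs : kmap h (0 : kos gs M) = 0.
  by elim: gs => [|f gs IH] //=; rewrite IH.
elim: fs j y => [|f fs IH] j y /=.
  case: j => [|j] /lift[x ->]; first by exists x.
  by move=> hx; exists 0; rewrite ?h0.
case: y => a b /= [/IH{}IHa IHb] [/IHa[a' ha' ->] hb].
case: j => [|j] in ha' hb *; first by rewrite hb; exists (a', 0); rewrite //= k0.
by have [b' hb' ->] := IH _ _ IHb hb; exists (a', b').
Qed.

Lemma kall_map0 fs M N (h : M -> N) (y : kos fs M) :
  kmap h y = 0 -> kall (fun x => h x = 0) y.
Proof. by elim: fs y => [|f fs IH] y //= [/IH ? /IH ?]. Qed.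

End Koszul.

(** * Ideal membership and Koszul cohomology of injective modules *)

Section Ideal.
Variable R : comNzRingType.

Fixpoint in_ideal (gs : seq R) (r : R) : Prop :=
  if gs is g :: gs' then exists c, in_ideal gs' (r - c * g) else r = 0.

Lemma in_idealP gs a x y :
  in_ideal gs x -> in_ideal gs y -> in_ideal gs (a * x + y).
Proof.
elim: gs x y => [|g gs IH] x y /=; first by move=> -> ->; rewrite mulr0 addr0.
move=> [c hc] [d hd]; exists (a * c + d).
by rewrite mulrDl opprD addrACA -mulrA -mulrBr; apply: IH.
Qed.

Lemma in_ideal0 gs : in_ideal gs 0.
Proof. by elim: gs => [|g gs IH] //=; exists 0; rewrite mul0r subr0. Qed.

Lemma in_idealM gs a x : in_ideal gs x -> in_ideal gs (a * x).
Proof. by move=> h; rewrite -[_ * _]addr0; apply: in_idealP (in_ideal0 _). Qed.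

Lemma in_ideal_mem gs g : g \in gs -> in_ideal gs g.
Proof.
elim: gs => [|h gs IH] //=; rewrite inE => /orP[/eqP ->|/IH hg].
  by exists 1; rewrite mul1r subrr; apply: in_ideal0.
by exists 0; rewrite mul0r subr0.
Qed.

Lemma in_ideal_annihilate gs (M : lmodType R) (x : M) r :
  (forall g, g \in gs -> g *: x = 0) -> in_ideal gs r -> r *: x = 0.
Proof.
elim: gs r => [|g gs IH] r h /=; first by move=> ->; rewrite scale0r.
case=> c /IH; rewrite scalerBl -scalerA (h g) ?inE ?eqxx // scaler0 subr0.
by apply=> g' hg'; apply: h; rewrite inE hg' orbT.
Qed.

(* The only consequence of noetherianity needed for local cohomology. *)
Definition colon_stable :=
  forall (gs : seq R) f, exists m, forall l r,
    in_ideal gs (f ^+ l * r) -> in_ideal gs (f ^+ m * r).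

(* Baer's criterion, for a partial homomorphism given by its graph. *)
Lemma injective_graph_ext (E : lmodType R) (G : R -> E -> Prop) :
  injective_module E -> G 0 0 ->
  (forall a x y e e', G x e -> G y e' -> G (a * x + y) (a *: e + e')) ->
  (forall e, G 0 e -> e = 0) ->
  exists w, forall x e, G x e -> e = x *: w.
Proof.
move=> Einj G0 Glin Gfun.
pose S : {pred R^o} := fun x => `[< exists e, G x e >].
have Scl : subsemimod_closed S.
  split; first split; first by apply/asboolP; exists 0.
    move=> x y /asboolP[e He] /asboolP[e' He']; apply/asboolP.
    by exists (1 *: e + e'); rewrite -[x]mul1r; apply: Glin.
  move=> a x /asboolP[e He]; apply/asboolP; exists (a *: e + 0).
  by rewrite -[_ *: x]addr0; apply: Glin.
pose N : submodClosed R^o :=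
  HB.pack_for (submodClosed R^o) S (GRing.isSubmodClosed.Build R R^o S Scl).
have Gex (x : submod N) : exists e, G (val x) e.
  by have /asboolP := valP x.
have [g Hg] := choice Gex.
have Guniq x e e' : G x e -> G x e' -> e = e'.
  move=> h1 h2; apply/eqP; rewrite -subr_eq0; apply/eqP/Gfun.
  by have := Glin (-1) x x _ _ h2 h1; rewrite mulN1r addNr scaleN1r addrC.
have glin : linear g.
  move=> a x y; apply: (Guniq (val (a *: x + y))); first exact: Hg.
  by rewrite linearP; apply: Glin; apply: Hg.
pose gL : {linear submod N -> E} :=
  HB.pack_for {linear submod N -> E} g (GRing.isLinear.Build R (submod N) E _ g glin).
have [h Hh] := Einj (submod N) R^o (val : {linear submod N -> R^o}) gL val_inj.
exists (h 1) => x e Hx.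
have xS : x \in N by apply/asboolP; exists e.
rewrite -linearZ /= -[x *: 1]/(x * 1) mulr1.
have := Hh (exist _ x xS : submod N); rewrite /= => ->.
exact: (Guniq x _ _ Hx (Hg (exist _ x xS))).
Qed.

(* Injective modules have no higher Koszul cohomology in the limit over t.  The
   crucial case is degree one in the last generator f: an element x killed by
   J = (f_1^t, ..., f_r^t) must be divided by a power of f inside the elements
   killed by J, which Baer's criterion does on the ideal J + (f^(t + m)). *)
Lemma kdiff_exact (E : lmodType R) : colon_stable -> injective_module E ->
  forall (fs : seq R) j (y : kos fs E) t, khom j.+1 y -> kdiff t y = 0 ->
  exists u, exists2 w, khom j w & ktrans u y = kdiff (t + u) w.
Proof.
move=> Rcol Einj; elim=> [|f fs IH] j y t.
  by move=> -> _; exists 0; exists 0; rewrite ?linear0 //; apply: khom0.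
case: y => a b [/= ha hb] [da]; move/subr0_eq => dab.
have [u1 [w1 hw1 ew1]] := IH _ _ _ ha da.
(* Subtracting the coboundary of [(w1, 0)] from the image of [(a, b)] under [ktrans u1] leaves
   [(0, b1)]. *)
pose b1 := f ^+ u1 *: ktrans u1 b - f ^+ (t + u1) *: w1.
have db1 : kdiff (t + u1) b1 = 0.
  rewrite /b1 raddfB /= !linearZ /= kdiff_trans -dab -ew1 linearZ /= scalerA.
  by rewrite scalerN -exprD addnC subrr.
have hb1 : khom j b1 by apply: khomB; apply: khomZ => //; apply: khom_trans.
suff [u2 [w2 hw2 ew2]] : exists u, exists2 w : kos (f :: fs) E, khom j w &
    (0, f ^+ u *: ktrans u b1) = kdiff (t + u1 + u) w.
  exists (u1 + u2)%N; exists (ktrans u2 ((w1, 0) : kos (f :: fs) E) + w2).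
    apply: (@khomD _ j (f :: fs)) => //; apply: (@khom_trans _ u2 j (f :: fs)).
    by split=> //=; case: (j) => [|j'] //; apply: khom0.
  change (ktrans (u1 + u2) ((a, b) : kos (f :: fs) E) =
    kdiff (t + (u1 + u2)) (ktrans u2 ((w1, 0) : kos (f :: fs) E) + w2)).
  have e1 : ktrans u1 ((a, b) : kos (f :: fs) E) =
      kdiff (t + u1) ((w1, 0) : kos (f :: fs) E) + (0, b1).
    apply: injective_projections => /=; first by rewrite ew1 addr0.
    by rewrite linear0 subr0 /b1 addrC subrK.
  rewrite addnA kdiffD -ew2 -ktrans_comp kdiff_trans e1 ktransD.
  by congr (_ + _); apply: injective_projections; rewrite /= ?linear0.
case: j => [|j] in ha hb hb1 hw1 *.
  have [x ex] := khom0_inc hb1.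
  have xann : forall g, g \in [seq f ^+ (t + u1) | f <- fs] -> g *: x = 0.
    move: db1; rewrite ex => /kdiff_inc h g /mapP[f' hf' ->]; exact: h.
  set J := [seq _ | _ <- _] in xann.
  have [m Hm] := Rcol J f.
  (* The homomorphism on [J + (f ^+ (t + u1 + m))] that kills [J] and sends the last generator to
     [f ^+ m *: x]; extending it to [R] yields [w] with [f ^+ (t + u1 + m) *: w = f ^+ m *: x]. *)
  pose G r (e : E) := exists a c,
    [/\ r = f ^+ (t + u1 + m) * a + c, in_ideal J c & e = (f ^+ m * a) *: x].
  have [|||w Hw] := @injective_graph_ext E G Einj.
  - by exists 0, 0; rewrite !mulr0 addr0 scale0r; split=> //; apply: in_ideal0.
  - move=> d r r' e e' [a1 [c1 [-> hc1 ->]]] [a2 [c2 [-> hc2 ->]]].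
    exists (d * a1 + a2), (d * c1 + c2); split; last first.
    + by rewrite scalerA -scalerDl; congr (_ *: _); rewrite mulrDr mulrCA.
    + exact: in_idealP.
    + by rewrite !mulrDr addrACA (mulrCA d).
  (* Well-definedness: if [f ^+ (t + u1 + m) * a1] lies in [J], so does [f ^+ m * a1] by the choice
     of [m], and [J] kills [x]. *)
  - move=> e [a1 [c1 [e1 hc1 ->]]]; apply: in_ideal_annihilate xann _.
    apply: (Hm (t + u1 + m)%N); have -> : f ^+ (t + u1 + m) * a1 = (-1) * c1.
      by apply/eqP; rewrite mulN1r -addr_eq0 -e1.
    exact: in_idealM.
  have wann g : g \in fs -> g ^+ (t + u1) *: w = 0.
    move=> hg; rewrite -(Hw (g ^+ (t + u1)) 0) //.
    exists 0, (g ^+ (t + u1)); split; rewrite ?mulr0 ?add0r ?scale0r //.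
    by apply: in_ideal_mem; apply: map_f.
  exists m; exists (kinc fs w, 0); first by split => //=; apply: kinc_hom.
  rewrite /= linear0 subr0 ex ktrans_inc -!linearZ /=; congr (_, kinc _ _).
    apply/esym/kdiff_inc => g hg; rewrite addnC exprD -scalerA wann //.
    by rewrite scaler0.
  apply: Hw; exists 1, 0; rewrite !mulr1 addr0; split=> //.
  exact: in_ideal0.
have [u2 [w2 hw2 ew2]] := IH _ _ _ hb1 db1.
exists u2; exists (0, - (f ^+ u2 *: w2)).
  split; first exact: khom0.
  by rewrite /= -scaleN1r; do 2!apply: khomZ.
rewrite /= linear0 scaler0 sub0r ew2; congr (_, _).
by rewrite linearN /= opprK linearZ.
Qed.

End Ideal.

(** * Local cohomology classes as Koszul cocycles *)

Section Zigzag.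
Variables (R : comNzRingType) (M : lmodType R) (E : injective_resolution M).
Variable fs : seq R.
Implicit Types (t u a b : nat) (g : kos fs M).

(* A staircase in the double complex K^a(E^b), from y in K^a(E^b) down to g in
   K^(a + b)(M). *)
Fixpoint zigzag t a b : kos fs (E b) -> kos fs M -> Prop :=
  match b return kos fs (E b) -> kos fs M -> Prop with
  | 0 => fun y g => y = kmap (ires_aug E) g
  | b'.+1 => fun y g => exists2 y', khom a y' &
      y = kmap (cdiff E b') y' /\ zigzag t a.+1 (kdiff t y') g
  end.

Lemma ires_lift0 a (y : kos fs (E 0)) : khom a y -> kmap (cdiff E 0) y = 0 ->
  exists2 g, khom a g & y = kmap (ires_aug E) g.
Proof.
move=> hy /kall_map0 ky; apply: (kmap_lift _ _ ky hy); first exact: linear0.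
by move=> x /ires_exact0.
Qed.

Lemma ires_liftS a b (y : kos fs (E b.+1)) : khom a y ->
  kmap (cdiff E b.+1) y = 0 -> exists2 y', khom a y' & y = kmap (cdiff E b) y'.
Proof.
move=> hy /kall_map0 ky; apply: (kmap_lift _ _ ky hy); first exact: linear0.
by move=> x /ires_exactS.
Qed.

Lemma kmap_cdiffK b (y : kos fs (E b)) :
  kmap (cdiff E b.+1) (kmap (cdiff E b) y) = 0.
Proof. by rewrite kmap_comp; apply: kmap_eq0 => x; apply: cdiffK. Qed.

(** By exactness of the resolution [y] lifts to some [y'], and [kdiff t y'] is again killed by both
    differentials, so the staircase continues down to [M]. *)
Lemma zigzag_exists t a b (y : kos fs (E b)) :
  khom a y -> kmap (cdiff E b) y = 0 -> kdiff t y = 0 ->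
  exists g, zigzag t a y g.
Proof.
elim: b a y => [|b IH] a y hy dy ky.
  by have [g _ eg] := ires_lift0 hy dy; exists g.
have [y' hy' ey] := ires_liftS hy dy.
have [||g zg] := IH a.+1 (kdiff t y') _ _ (kdiffK t y').
- exact: khom_diff.
- by rewrite kmap_diff -ey.
by exists g, y'.
Qed.

Lemma zigzagZ t a b r (y : kos fs (E b)) g :
  zigzag t a y g -> zigzag t a (r *: y) (r *: g).
Proof.
elim: b a y => [|b IH] a y /=; first by move=> ->; rewrite linearZ.
move=> [v hv [-> zv]]; exists (r *: v); first exact: khomZ.
by rewrite !linearZ; split=> //; apply: IH.
Qed.

Lemma zigzag_trans t u a b (y : kos fs (E b)) g :
  zigzag t a y g -> zigzag (t + u) a (ktrans u y) (ktrans u g).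
Proof.
elim: b a y => [|b IH] a y /=; first by move=> ->; rewrite kmap_trans.
move=> [v hv [-> zv]]; exists (ktrans u v); first exact: khom_trans.
by rewrite kmap_trans kdiff_trans; split=> //; apply: IH.
Qed.

(** [v] lifts along the resolution to some [v']; subtracting [kdiff t v'] from the next stair gives
    the same situation one row lower, until [v] comes from [M]. *)
Lemma zigzag_bound t a b (v : kos fs (E b)) g : khom a v ->
  kmap (cdiff E b) v = 0 -> zigzag t a.+1 (kdiff t v) g ->
  exists2 h, khom (a + b) h & g = kdiff t h.
Proof.
elim: b a v => [|b IH] a v hv dv /=.
  have [h hh ev] := ires_lift0 hv dv; rewrite ev -kmap_diff.
  move/(kmap_inj (@ires_aug_inj _ _ E)) => <-; exists h => //.
  by rewrite addn0.
move=> [y hy [ey zy]]; have [v' hv' ev] := ires_liftS hv dv.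
have := IH a.+1 (y - kdiff t v'); rewrite addSnnS; apply.
- by apply: khomB => //; apply: khom_diff.
- by rewrite raddfB /= -ey kmap_diff -ev subrr.
by rewrite raddfB /= kdiffK subr0.
Qed.

(** The converse direction. At each stair a Koszul cocycle over an injective module has to be
    bounded, which [kdiff_exact] achieves after a transition map; hence the shift [u]. *)
Lemma zigzag_unbound t a b (v : kos fs (E b)) (h : kos fs M) :
  colon_stable R -> khom a v -> khom (a + b) h ->
  zigzag t a.+1 (kdiff t v) (kdiff t h) ->
  exists u, exists2 v', khom a v' & kdiff (t + u) v' = 0 /\
    kmap (cdiff E b) v' = kmap (cdiff E b) (ktrans u v).
Proof.
move=> Rcol; elim: b a v => [|b IH] a v hv hh /=.
  rewrite addn0 in hh; rewrite kmap_diff => ev; exists 0.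
  exists (ktrans 0 (v - kmap (ires_aug E) h)).
    by apply/khom_trans/khomB => //; apply: khom_map => //; apply: linear0.
  rewrite kdiff_trans raddfB /= ev subrr linear0; split=> //.
  rewrite !kmap_trans raddfB /= kmap_comp [X in _ - X]kmap_eq0 ?subr0 //.
  by move=> x /=; apply/ires_exact0; exists x.
move=> [y hy [ey zy]].
have [|u1 [y1 hy1 [dy1 ey1]]] := IH a.+1 y hy _ zy; first by rewrite addSnnS.
have [u2 [w hw ew]] := kdiff_exact Rcol (@ires_inj _ _ E b) hy1 dy1.
exists (u1 + u2)%N; exists (ktrans (u1 + u2) v - kmap (cdiff E b) w).
  by apply/khomB; [apply: khom_trans|apply: khom_map => //; apply: linear0].
rewrite raddfB /= raddfB /= kmap_cdiffK subr0; split=> //.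
rewrite kdiff_trans addnA -kmap_diff -ew kmap_trans ey1 kmap_trans.
by rewrite ktrans_comp -ey subrr.
Qed.

Lemma zigzag_bound0 t b (e : E b.+1) (e' : E b) g : e = cdiff E b e' ->
  (forall f, f \in fs -> f ^+ t *: e' = 0) -> zigzag t 0 (kinc fs e) g ->
  exists2 h, khom b h & g = kdiff t h.
Proof.
move=> ee he' /= [y hy [ey zy]].
have := @zigzag_bound t 0 b (y - kinc fs e') g; apply.
- by apply: khomB => //; apply: kinc_hom.
- by rewrite raddfB /= -ey kmap_inc -ee subrr.
by rewrite raddfB /= [kdiff t (kinc fs e')](kdiff_inc _ _ _).2 // subr0.
Qed.

Lemma zigzag_unbound0 t b (e : E b.+1) (h : kos fs M) : colon_stable R ->
  khom b h -> zigzag t 0 (kinc fs e) (kdiff t h) ->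
  exists u (e' : E b), e = cdiff E b e' /\
    forall f, f \in fs -> f ^+ u *: e' = 0.
Proof.
move=> Rcol hh /= [y hy [ey zy]].
have [u [v hv [dv ev]]] := @zigzag_unbound t 0 b y h Rcol hy hh zy.
have [e' ee'] := khom0_inc hv; exists (t + u)%N, e'.
split; last by apply/kdiff_inc; rewrite -ee'.
apply: (@kinc_inj _ fs); rewrite -kmap_inc -ee' ev kmap_trans -ey.
by rewrite ktrans_inc.
Qed.

End Zigzag.

Section Torsion.
Variables (R : comNzRingType) (s : nat) (f : 'I_s -> R).

Lemma ideal_gen_mem j : f j \in ideal_gen f.
Proof.
apply/asboolP; exists (fun l => (l == j)%:R); rewrite (bigD1 j) //= eqxx mul1r.
by rewrite big1 ?addr0 // => l /negbTE ->; rewrite mul0r.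
Qed.

Lemma ideal_exp_gen t j : f j ^+ t \in ideal_exp (ideal_gen f) t.
Proof.
apply/asboolP; exists 1, (fun _ => 1), (fun _ _ => f j); split.
  by move=> _ _; apply: ideal_gen_mem.
by rewrite big_ord1 mul1r prodr_const card_ord.
Qed.

(** Pigeonhole: a product of more than [\sum_j u j] generators contains some [f j] at least [u j]
    times. The induction replaces [x] by [f j *: x] and lowers [u j] by one. *)
Lemma ideal_prod_annihilate (M : lmodType R) T (a : 'I_T -> R)
    (u : 'I_s -> nat) (x : M) :
  (\sum_j u j < T)%N -> (forall i, a i \in ideal_gen f) ->
  (forall j, f j ^+ u j *: x = 0) -> (\prod_i a i) *: x = 0.
Proof.
elim: T a u x => [|T IH] a u x //= ltu aI ux.
rewrite big_ord_recl mulrC -scalerA.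
have /asboolP[c ->] := aI ord0.
rewrite scaler_suml scaler_sumr big1 // => j _.
rewrite -scalerA scalerA mulrC -scalerA.
have [uj0|uj0] := posnP (u j).
  have x0 : x = 0 by rewrite -(ux j) uj0 expr0 scale1r.
  by rewrite x0 !scaler0.
pose u' l := if l == j then (u j).-1 else u l.
rewrite (IH _ u') ?scaler0 //.
  move: ltu; rewrite (bigD1 j) //= [X in _ -> (X < _)%N](bigD1 j) //=.
  rewrite {1}/u' eqxx -{1}(prednK uj0) addSn ltnS; apply: leq_ltn_trans.
  by rewrite leq_add2l; apply: leq_sum => l /negbTE lj; rewrite /u' lj.
move=> l; rewrite /u'; case: eqP => [->|_].
  by rewrite scalerA -exprSr prednK.
by rewrite scalerA mulrC -scalerA ux scaler0.
Qed.

Lemma torsion_gen (M : lmodType R) (x : M) :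
  x \in @torsion R (ideal_gen f) M <-> exists u, forall j, f j ^+ u *: x = 0.
Proof.
split=> [/asboolP[t ht]|[u hu]].
  by exists t => j; apply/ht/ideal_exp_gen.
apply/asboolP; exists (\sum_(j < s) u).+1 => r /asboolP[m [c [a [aI ->]]]].
rewrite scaler_suml big1 // => i _; rewrite -scalerA.
by rewrite (@ideal_prod_annihilate _ _ _ (fun=> u)) ?scaler0.
Qed.

End Torsion.

Lemma quotmod_scale_eq0 (R : comNzRingType) (V : lmodType R)
    (N : submodClosed V) (r : R) (x : V) :
  (r *: (\pi_(Quotient.quot (submod_zmod N)) x : quotmod N) == 0) = (r *: x \in N).
Proof.
rewrite -[LHS]/(quotmod_scale r _ == 0) quotmod_scale_pi.
rewrite -[0 in LHS](raddf0 (\pi_(Quotient.quot (submod_zmod N)))).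
by rewrite -Quotient.idealrBE subr0.
Qed.

(** In degree 0 a coboundary is zero; in positive degree the primitive has to be required
    homogeneous, since [kos] does not carry the grading. *)
Definition kcob (R : comNzRingType) (fs : seq R) (M : lmodType R) t i
    (y : kos fs M) : Prop :=
  if i is j.+1 then exists2 h, khom j h & y = kdiff t h else y = 0.

(** Unwinds the quotient and the nested subtypes, so that the comparison with Koszul cochains deals
    with plain elements of the resolution. *)
Lemma local_cohomology_repr (R : comNzRingType) (I : {pred R})
    (M : lmodType R) (E : injective_resolution M) i
    (z : local_cohomology I E i) :
  exists e : E i, [/\ cdiff E i e = 0, e \in @torsion R I (E i) &
    forall r, r *: z = 0 <->
      match i return E i -> Prop with
      | 0 => fun e => e = 0
      | b.+1 => fun e => exists2 e', e' \in @torsion R I (E b) & e = cdiff E b e'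
      end (r *: e)].
Proof.
pose x : cocycles (Gamma_complex I E) i := repr z.
have zx : z = \pi_(Quotient.quot (submod_zmod _)) x by rewrite reprK.
pose y : Gamma I (E i) := val x; pose e : E i := val y.
have de : cdiff E i e = 0 by have /eqP/(congr1 val) := valP x.
exists e; split; [exact: de|exact: (valP y)|] => r.
have ze : r *: z = 0 <-> r *: x \in @coboundary _ (Gamma_complex I E) i.
  by rewrite zx; split=> [/eqP|h]; [|apply/eqP]; rewrite quotmod_scale_eq0.
have vx : val (val (r *: x)) = r *: e by rewrite !linearZ.
apply: (iff_trans ze); move: (r *: x) (r *: e) vx.
case: (i) => [|b] v w <- {x zx y e de z ze}.
  split=> [/eqP ->|h]; first by [].
  by apply/eqP/val_inj/val_inj.
split=> [/asboolP[y' ->]|[e' te' ee]]; first by exists (val y'); rewrite ?(valP y').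
by apply/asboolP; exists (exist _ e' te' : Gamma I (E b)); apply: val_inj.
Qed.

(** A representative [e] of [z] is killed by powers of the generators, so [kinc fs e] is a Koszul
    cocycle of degree 0, and a staircase carries it to [g]. If [r] kills [z], coboundaries appear
    for all large [u]; conversely, a coboundary at a single [u] suffices. *)
Lemma local_cohomology_koszul (R : comNzRingType) (s : nat) (f : 'I_s -> R)
    (M : lmodType R) (E : injective_resolution M) i
    (z : local_cohomology (ideal_gen f) E i) (fs := codom f) :
  colon_stable R -> exists t (g : kos fs M),
    (forall r, r *: z = 0 ->
       exists u0, forall u, (u0 <= u)%N -> kcob (t + u) i (r *: ktrans u g)) /\
    (forall r u, kcob (t + u) i (r *: ktrans u g) -> r *: z = 0).
Proof.
move=> Rcol; have fsP (V : lmodType R) (x : V) t :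
    (forall h, h \in fs -> h ^+ t *: x = 0) <-> forall j, f j ^+ t *: x = 0.
  by split=> [h j|h g /codomP[j ->]]; rewrite ?h //; apply: codom_f.
have [e [de /torsion_gen[t te] ze]] := local_cohomology_repr z.
have [|||g zg] := @zigzag_exists R M E fs t 0 i (kinc fs e).
- exact: kinc_hom.
- by rewrite kmap_inc de linear0.
- by apply/kdiff_inc/fsP.
have zgu r u : zigzag (t + u) 0 (kinc fs (r *: e)) (r *: ktrans u g).
  have -> : kinc fs (r *: e) = r *: ktrans u (kinc fs e).
    by rewrite ktrans_inc linearZ.
  by apply/zigzagZ/zigzag_trans.
exists t, g; split=> [r /ze|r u hc].
  case: (i) e g zgu {z de te ze zg} => [|b] e g zgu /=.
    move=> re0; exists 0 => u _ /=; have := zgu r u.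
    rewrite re0 /= linear0 => /esym; rewrite -(linear0 (kmap (ires_aug E))).
    exact/kmap_inj/ires_aug_inj.
  move=> [e' /torsion_gen[u0 hu0] ee]; exists u0 => u le_u.
  apply: (zigzag_bound0 ee _ (zgu r u)); apply/fsP => j.
  by rewrite -(subnK (leq_trans le_u (leq_addl t u))) exprD -scalerA hu0 scaler0.
apply/ze; case: (i) e g zgu hc {z de te ze zg} => [|b] e g zgu /= hc.
  apply: (@kinc_inj _ fs).
  by have := zgu r u; rewrite hc /= !linear0.
have [h hh eh] := hc; have := zgu r u; rewrite eh => zz.
have [u' [e' [ee he']]] := zigzag_unbound0 Rcol hh zz.
by exists e' => //; apply/torsion_gen; exists u'; apply/fsP.
Qed.

(** * Noetherianity of polynomial rings *)

Section Dickson.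
Variable n : nat.

(** Induction on the coordinates. A finite set [ms0] that works for the old ones also works for the
    new coordinate [i] where [m i] is at least the maximum [B] over [ms0]; the finitely many slices
    [m i = b] with [b < B] are handled separately. *)
Lemma dickson_coords (V : seq 'I_n) (L : 'X_{1..n} -> Prop) :
  exists ms : seq 'X_{1..n}, (forall m, m \in ms -> L m) /\
    forall m, L m -> exists2 m', m' \in ms & forall i, i \in V -> (m' i <= m i)%N.
Proof.
elim: V L => [|i V IH] L.
  have [[m Lm]|nL] := pselect (exists m, L m).
    exists [:: m]; split=> [m'|m' _]; first by rewrite inE => /eqP ->.
    by exists m; rewrite ?inE.
  by exists [::]; split=> // m Lm; case: nL; exists m.
have [ms0 [ms0L ms0P]] := IH L.
have [ms msP] := choice (fun b => IH (fun m => L m /\ m i = b)).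
pose B := \max_(m <- ms0) m i.
exists (ms0 ++ flatten [seq ms b | b <- iota 0 B]); split.
  move=> m; rewrite mem_cat => /orP[/ms0L //|/flattenP[_ /mapP[b _ ->]]].
  by move=> /(msP b).1[].
move=> m Lm; have [ltB|leB] := ltnP (m i) B.
  have [m' m'ms m'P] := (msP (m i)).2 m (conj Lm erefl).
  exists m'.
    rewrite mem_cat; apply/orP/or_intror/flattenP; exists (ms (m i)) => //.
    by apply: map_f; rewrite mem_iota.
  move=> j; rewrite inE => /orP[/eqP ->|/m'P //].
  by have [_ ->] := (msP (m i)).1 _ m'ms.
have [m' m'ms m'P] := ms0P m Lm; exists m'; first by rewrite mem_cat m'ms.
move=> j; rewrite inE => /orP[/eqP ->|/m'P //]; apply: leq_trans leB.
by rewrite /B (big_rem m') //= leq_maxl.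
Qed.

Lemma dickson (L : 'X_{1..n} -> Prop) :
  exists ms : seq 'X_{1..n}, (forall m, m \in ms -> L m) /\
    forall m, L m -> exists2 m', m' \in ms & (m' <= m)%MM.
Proof.
have [ms [msL msP]] := dickson_coords (enum 'I_n) L.
exists ms; split=> // m /msP[m' m'ms m'P]; exists m' => //.
by apply/mnm_lepP => i; apply: m'P; rewrite mem_enum.
Qed.

End Dickson.

Section HilbertBasis.
Variables (k : fieldType) (n : nat).
Local Notation R := {mpoly k[n]}.

Lemma mlead_reduce (r g : R) : r != 0 -> g != 0 -> (mlead g <= mlead r)%MM ->
  exists a, r - a * g = 0 \/ (mlead (r - a * g) < mlead r)%O.
Proof.
move=> r0 g0 le_gr; set d := (mlead r - mlead g)%MM.
pose a := ((r@_(mlead r) / g@_(mlead g)) *: 'X_[d] : R).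
have dg : (d + mlead g = mlead r)%MM by rewrite /d submK.
exists a; have [->|nz] := eqVneq (r - a * g) 0; [by left|right].
have le1 : (mlead (a * g) <= mlead r)%O.
  apply: le_trans (mleadM_le _ _) _; rewrite -dg.
  by apply: lem_add => //; rewrite -[X in (_ <= X)%O](@mleadXm _ k); apply: mleadZ_le.
have le2 : (mlead (r - a * g) <= mlead r)%O.
  apply: le_trans (mleadB_le _ _) _.
  by rewrite leUx lexx le1.
rewrite lt_neqAle le2 andbT; apply/eqP => e.
have cag : (a * g)@_(mlead r) = r@_(mlead r).
  rewrite /a -scalerAl mcoeffZ [_ * g]mulrC.
  have -> : (g * 'X_[d])@_(mlead r) = g@_(mlead g) by rewrite -dg mcoeffMX.
  by rewrite divfK // mleadc_eq0.
by move: nz; rewrite -mleadc_eq0 e mcoeffB cag subrr eqxx.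
Qed.

(** Hilbert's basis theorem: Dickson's lemma yields finitely many minimal leading monomials, and
    division by elements realizing them ends because the monomial order is well-founded. *)
Lemma mpoly_ideal_fg (I : R -> Prop) :
  (forall a x y, I x -> I y -> I (a * x + y)) ->
  exists gs, (forall g, g \in gs -> I g) /\ forall r, I r -> in_ideal gs r.
Proof.
move=> Ilin.
have [ms [msL msP]] := dickson (fun m => exists r, [/\ I r, r != 0 & mlead r = m]).
have Gex m : exists g, m \in ms -> [/\ I g, g != 0 & mlead g = m].
  by have [/msL[r hr]|_] := boolP (m \in ms); [exists r|exists 0].
have [G GP] := choice Gex.
exists (map G ms); split=> [_ /mapP[m /GP[? _ _] ->] //|r Ir].
move: {2}(mlead r) (erefl (mlead r)) => m0; move: m0 r Ir; apply: ltmwf => m0 IH r Ir em.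
have [->|r0] := eqVneq r 0; first exact: in_ideal0.
have [|m' m'ms le_m] := msP (mlead r); first by exists r.
have [IG G0 lG] := GP _ m'ms.
have [|a Ha] := mlead_reduce r0 G0; first by rewrite lG.
have IG' : in_ideal (map G ms) (G m') by apply/in_ideal_mem/map_f.
rewrite -[r](subrK (a * G m')) addrC; apply: in_idealP => //.
case: Ha => [->|lt]; first exact: in_ideal0.
apply: (IH _ _ _ _ (erefl _)); first by rewrite -em.
by rewrite addrC -mulNr; apply: Ilin.
Qed.

(** The union of the colon ideals of [f ^+ l] is an ideal, hence finitely generated; one exponent
    that serves its generators serves all of it. *)
Lemma mpoly_colon_stable : colon_stable R.
Proof.
move=> gs f.
have [|bs [bsI bsP]] := @mpoly_ideal_fg (fun r => exists l, in_ideal gs (f ^+ l * r)).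
  move=> a x y [l hl] [l' hl']; exists (l + l')%N.
  rewrite mulrDr mulrCA; apply: in_idealP.
    by rewrite addnC exprD -mulrA; apply: in_idealM.
  by rewrite exprD -mulrA; apply: in_idealM.
have [m Hm] : exists m, forall b, b \in bs -> in_ideal gs (f ^+ m * b).
  elim: bs bsI {bsP} => [|b bs IH] bsI; first by exists 0.
  have [|m Hm] := IH; first by move=> g hg; apply: bsI; rewrite inE hg orbT.
  have [|l hl] := bsI b; first by rewrite inE eqxx.
  exists (m + l)%N => g; rewrite inE => /orP[/eqP ->|/Hm hg].
    by rewrite exprD -mulrA; apply: in_idealM.
  by rewrite addnC exprD -mulrA; apply: in_idealM.
exists m => l r hlr; have {hlr} : in_ideal bs r by apply: bsP; exists l.
elim: bs Hm r {bsI bsP} => [|b bs IH] Hm r /=.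
  by move=> ->; rewrite mulr0; apply: in_ideal0.
case=> c hc; rewrite -[r](subrK (c * b)) addrC mulrDr mulrCA.
apply: in_idealP; first by apply: Hm; rewrite inE eqxx.
by apply: IH hc => g hg; apply: Hm; rewrite inE hg orbT.
Qed.

End HilbertBasis.

(** * Polynomials over the q-th powers of the variables *)

Section Support.
Variables (k : fieldType) (n : nat).
Local Notation R := {mpoly k[n]}.
Implicit Types (f g : R) (m w a : 'X_{1..n}) (U V : {set 'I_n}).

Definition mono_in (G : pred 'X_{1..n}) : {pred R} := fun f => all G (msupp f).

Lemma mono_inP (G : pred 'X_{1..n}) f :
  reflect (forall m, f@_m != 0 -> G m) (f \in mono_in G).
Proof.
by apply: (iffP allP) => h m; [rewrite -mcoeff_msupp|rewrite mcoeff_msupp]; apply: h.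
Qed.

Lemma mono_inX (G : pred 'X_{1..n}) m : G m -> 'X_[m] \in mono_in G.
Proof. by move=> Gm; rewrite /in_mem /= /mono_in msuppX /= Gm. Qed.

Lemma mono_inC (G : pred 'X_{1..n}) c : G 0%MM -> c%:MP \in mono_in G.
Proof. by move=> Gm; rewrite /in_mem /= /mono_in msuppC; case: eqP => //= _; rewrite Gm. Qed.

Lemma mono_in_subring (G : pred 'X_{1..n}) : G 0%MM ->
  (forall m w, G m -> G w -> G (m + w)%MM) -> subring_closed (mono_in G).
Proof.
move=> G0 GD; split; first by rewrite -mpolyC1; apply: mono_inC.
  move=> f g /allP hf /allP hg; apply/allP => m /msuppB_le.
  by rewrite mem_cat => /orP[/hf|/hg].
move=> f g /allP hf /allP hg; apply/allP => m /msuppM_le /allpairsP[[m1 m2]].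
by case=> /= /hf h1 /hg h2 ->; apply: GD.
Qed.

Definition vars_in U m := [forall (i | i \notin U), m i == 0%N].
Definition dvd_off q U m := [forall (i | i \notin U), (q %| m i)%N].
(** For [q > 0] these are the exponents of the monomial basis of the polynomial ring over
    k[x_U][x_i^q : i notin U]. *)
Definition box q U a := [forall i, if i \in U then a i == 0%N else (a i < q)%N].

(* mvars U is k[x_U]; mpow q U is k[x_U][x_i^q : i \notin U]. *)
Definition mvars U := mono_in (vars_in U).
Definition mpow q U := mono_in (dvd_off q U).

Lemma vars_inP U m : reflect (forall i, i \notin U -> m i = 0%N) (vars_in U m).
Proof. by apply: (iffP forall_inP) => h i /h => [/eqP|->]. Qed.

Lemma mvars_subring U : subring_closed (mvars U).
Proof.
apply: mono_in_subring => [|m w /vars_inP hm /vars_inP hw]; apply/vars_inP => i hi.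
  by rewrite mnm0E.
by rewrite mnmDE hm ?hw.
Qed.
HB.instance Definition _ U := GRing.isSubringClosed.Build R (mvars U) (mvars_subring U).

Lemma mpow_subring q U : subring_closed (mpow q U).
Proof.
apply: mono_in_subring => [|m w /forall_inP hm /forall_inP hw]; apply/forall_inP => i hi.
  by rewrite mnm0E dvdn0.
by rewrite mnmDE dvdn_add ?hm ?hw.
Qed.
HB.instance Definition _ q U := GRing.isSubringClosed.Build R (mpow q U) (mpow_subring q U).

Lemma mvars_mpow q U f : f \in mvars U -> f \in mpow q U.
Proof.
move=> /allP hf; apply/allP => m /hf /vars_inP h; apply/forall_inP => i /h ->.
exact: dvdn0.
Qed.

Lemma mvarsS U V f : U \subset V -> f \in mvars U -> f \in mvars V.
Proof.
move=> UV /allP hf; apply/allP => m /hf /vars_inP h; apply/vars_inP => i iV.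
by apply: h; apply: contra iV; apply: (subsetP UV).
Qed.

Lemma mvarsX U i : i \in U -> 'X_i \in mvars U.
Proof.
move=> iU; apply: mono_inX; apply/vars_inP => j; rewrite mnm1E.
by case: eqP => // <-; rewrite iU.
Qed.

Lemma mvarsC U c : c%:MP \in mvars U.
Proof. by apply: mono_inC; apply/vars_inP => i; rewrite mnm0E. Qed.

Lemma mcoeffXM m f w :
  ('X_[m] * f)@_w = if (m <= w)%MM then f@_(w - m) else 0.
Proof.
rewrite mulrC; case: ifPn => [le_mw|nle].
  by rewrite -{1}(submK le_mw) addmC mcoeffMX.
apply: memN_msupp_eq0; apply: contra nle => /msuppM_le /allpairsP[[m1 m2]] /=.
by rewrite msuppX inE => -[_ /eqP -> ->]; apply: lem_addl.
Qed.

(** Raising to the power [p ^ e] is additive in characteristic [p], so only powers of monomials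
    occur. Hence the Koszul differential at exponent [p ^ e] is linear over [mpow (p ^ e) U]. *)
Lemma frobenius_mpow p e U f : p \in [pchar k] -> f ^+ (p ^ e) \in mpow (p ^ e) U.
Proof.
move=> pk; have pR : p \in [pchar R].
  rewrite inE (pcharf_prime pk) /= -mpolyC_nat.
  by have /andP[_ /eqP ->] := pk; rewrite mpolyC0.
elim/mpolyind: f => [|c m f _ _ IH].
  by rewrite expr0n; case: eqP; rewrite ?rpred0 ?rpred1.
rewrite exprDn_pchar; last first.
  by rewrite pnatX (eq_pnat _ (pcharf_eq pR)) pnat_id ?(pcharf_prime pk).
rewrite rpredD // -mul_mpolyC exprMn -rmorphXn /= mpolyXn rpredM //.
  by apply/mvars_mpow/mvarsC.
by apply: mono_inX; apply/forall_inP => i _; rewrite mulmnE dvdn_mull.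
Qed.

(* For G := dvd_off q U and a in box q U, this is the coordinate of f on x^a over
   the subring mpow q U. *)
Definition cpart (G : pred 'X_{1..n}) a f : R :=
  \sum_(m : 'X_{1..n < msize f}) (if G m then f@_(m + a) else 0) *: 'X_[m].

Lemma cpartE G a f w : (cpart G a f)@_w = if G w then f@_(w + a) else 0.
Proof.
have [lt|ge] := ltnP (mdeg w) (msize f).
  by rewrite (mcoeff_mpoly (fun m => if G m then f@_(m + a) else 0)).
rewrite (memN_msupp_eq0 (p := f)) ?if_same; last first.
  by apply: msize_mdeg_ge; rewrite mdegD (leq_trans ge) ?leq_addr.
rewrite raddf_sum big1 // => m _; rewrite /= mcoeffZ mcoeffX.
case: eqP => [e|]; last by rewrite mulr0.
by have := bmdeg m; rewrite e ltnNge ge.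
Qed.

Lemma cpartD G a f g : cpart G a (f + g) = cpart G a f + cpart G a g.
Proof.
by apply/mpolyP => w; rewrite mcoeffD !cpartE mcoeffD; case: ifP; rewrite ?addr0.
Qed.

Lemma cpartB G a f g : cpart G a (f - g) = cpart G a f - cpart G a g.
Proof.
by apply/mpolyP => w; rewrite mcoeffB !cpartE mcoeffB; case: ifP; rewrite ?subr0.
Qed.

Lemma cpart0 G a : cpart G a 0 = 0.
Proof. by apply/mpolyP => w; rewrite cpartE !mcoeff0 if_same. Qed.

Lemma cpartZ G a c f : cpart G a (c *: f) = c *: cpart G a f.
Proof.
by apply/mpolyP => w; rewrite mcoeffZ !cpartE mcoeffZ; case: ifP; rewrite ?mulr0.
Qed.

Lemma cpart_sum G a (I : Type) (r : seq I) (F : I -> R) :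
  cpart G a (\sum_(i <- r) F i) = \sum_(i <- r) cpart G a (F i).
Proof. exact: (big_morph (cpart G a) (cpartD G a) (cpart0 G a)). Qed.

Lemma cpart_deg G a f : (msize f <= mdeg a)%N -> cpart G a f = 0.
Proof.
move=> le; apply/mpolyP => w; rewrite cpartE mcoeff0.
rewrite (memN_msupp_eq0 (p := f)) ?if_same //.
by apply: msize_mdeg_ge; rewrite mdegD (leq_trans le) ?leq_addl.
Qed.

Lemma boxP q U a : reflect
  ((forall i, i \in U -> a i = 0%N) /\ forall i, i \notin U -> (a i < q)%N)
  (box q U a).
Proof.
apply: (iffP forallP) => [h|[h1 h2] i].
  by split=> i hi; have := h i; rewrite ?hi ?(negbTE hi) // => /eqP.
by case: ifPn => [/h1 ->|/h2].
Qed.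

(** The point is that [m i <= w i + a i] forces [m i <= w i] off [U], because [m i] and [w i] are
    multiples of [q] and [a i < q]. *)
Lemma cpartXl q U a m f : box q U a -> dvd_off q U m ->
  cpart (dvd_off q U) a ('X_[m] * f) = 'X_[m] * cpart (dvd_off q U) a f.
Proof.
move=> /boxP[aU aq] /forall_inP mq; apply/mpolyP => w.
rewrite cpartE !mcoeffXM cpartE.
have [le_mw|nle] := boolP (m <= w)%MM.
  have -> : dvd_off q U (w - m) = dvd_off q U w.
    apply: eq_forallb => i; case: (boolP (i \notin U)) => //= iU.
    rewrite mnmBE; apply: dvdn_subl; last exact: mq.
    exact: (mnm_lepP le_mw).
  case: ifP => // _.
  rewrite ifT; last by apply: lepm_trans le_mw (lem_addr _ _).
  congr (_@_ _); apply/mnmP => i; rewrite !(mnmBE, mnmDE) addnBAC //.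
  exact: (mnm_lepP le_mw).
case: ifP => // /forall_inP wq; case: ifP => // /mnm_lepP le.
case/negP: nle; apply/mnm_lepP => i.
have := le i; rewrite mnmDE; have [iU|iU] := boolP (i \in U).
  by rewrite aU // addn0.
have /dvdnP[x ->] := mq _ iU; have /dvdnP[y ->] := wq _ iU => h.
have : (x * q < y.+1 * q)%N.
  by rewrite mulSn addnC; apply: leq_ltn_trans h _; rewrite ltn_add2l aq.
by rewrite ltn_mul2r ltnS => /andP[_ /leq_mul]; apply.
Qed.

Lemma cpart_semilinear q U a l f : box q U a -> l \in mpow q U ->
  cpart (dvd_off q U) a (l * f) = l * cpart (dvd_off q U) a f.
Proof.
move=> ba /allP lq; rewrite (mpolyE l) !mulr_suml cpart_sum.
rewrite big_seq [RHS]big_seq; apply: eq_bigr => m /lq hm.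
by rewrite -!scalerAl cpartZ cpartXl.
Qed.

Lemma cpart_shift G (b : 'X_{1..n}) i j f : (j <= b i)%N ->
  cpart G b ('X_i ^+ j * f) = cpart G (b - U_(i) *+ j)%MM f.
Proof.
move=> le; apply/mpolyP => w; rewrite !cpartE; case: ifP => // _.
have le_b : (U_(i) *+ j <= b)%MM.
  by apply/mnm_lepP => l; rewrite mulmnE mnm1E; case: eqP => [<-|]; rewrite ?mul1n.
rewrite mpolyXn mcoeffXM ifT; last exact: lepm_trans le_b (lem_addl _ _).
congr (_@_ _); apply/mnmP => l; rewrite !(mnmBE, mnmDE) addnBA //.
exact: (mnm_lepP le_b).
Qed.

(** Euclidean division by [q] of the exponents off [U] gives the only [a] in the box that
    contributes at [w]. The degree bound makes the index type finite and still contains the whole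
    box. *)
Lemma cpart_decomp q U f : (0 < q)%N ->
  f = \sum_(a : 'X_{1..n < (n * q).+1} | box q U a)
        'X_[a] * cpart (dvd_off q U) a f.
Proof.
move=> q0; apply/mpolyP => w; rewrite raddf_sum /=.
have termE (a : 'X_{1..n}) : ('X_[a] * cpart (dvd_off q U) a f)@_w =
    if (a <= w)%MM && dvd_off q U (w - a)%MM then f@_w else 0.
  by rewrite mcoeffXM cpartE; case: (boolP (a <= w)%MM) => //= le; rewrite submK.
under [RHS]eq_bigr do rewrite termE.
pose a0 := [multinom (if i \in U then 0 else w i %% q)%N | i < n].
have a0d : (mdeg a0 < (n * q).+1)%N.
  rewrite ltnS mdegE -[X in (X * q)%N]card_ord -sum_nat_const.
  by apply: leq_sum => i _; rewrite mnmE; case: ifP => // _; rewrite ltnW // ltn_mod.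
have a0w : (a0 <= w)%MM.
  by apply/mnm_lepP => i; rewrite mnmE; case: ifP => // _; apply: leq_mod.
rewrite (bigD1 (Sub a0 a0d)) /=; last first.
  by apply/boxP; split=> i iU; rewrite mnmE ?iU ?(negbTE iU) ?ltn_mod.
rewrite a0w ifT; last first.
  apply/forall_inP => i iU; rewrite mnmBE mnmE (negbTE iU).
  by rewrite {1}(divn_eq (w i) q) addnK dvdn_mull.
rewrite big1 ?addr0 // => a /andP[/boxP[aU aq] /eqP ne].
case: ifP => // /andP[/mnm_lepP le /forall_inP dv].
case: ne; apply/val_inj/mnmP => i; rewrite mnmE /=.
case: ifPn => [/aU //|iU]; have := dv _ iU; rewrite mnmBE => /dvdnP[c ec].
by rewrite -(subnK (le i)) ec modnMDl modn_small // aq.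
Qed.

End Support.

Section KoszulMaps.
Variables (R : comNzRingType) (fs : seq R) (M N : lmodType R).

(** Stated without linearity of [h] in order to apply to [cpart], which commutes with multiplication
    by [f ^+ t] only for suitable [t]. *)
Lemma kmap_diff_semi t (h : M -> N) (y : kos fs M) :
  {morph h : a b / a - b} ->
  (forall f x, f \in fs -> h (f ^+ t *: x) = f ^+ t *: h x) ->
  kmap h (kdiff t y) = kdiff t (kmap h y).
Proof.
move=> hB hZ.
have kB gs : {morph (@kmap R gs M N h) : a b / a - b}.
  by elim: gs => //= f gs IH [a1 a2] [b1 b2]; apply: injective_projections; apply: IH.
elim: fs y hZ => [|f gs IH] y hZ /=; first by rewrite -(subrr 0) hB subrr.
have kZ hs : {subset hs <= f :: gs} -> forall v : kos hs M,
    kmap h (f ^+ t *: v) = f ^+ t *: kmap h v.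
  elim: hs => [|g hs IHh] sub v /=; first by apply: hZ; rewrite inE eqxx.
  by apply: injective_projections; apply: IHh => g' hg'; apply: sub; rewrite inE hg' orbT.
have IH' (v : kos gs M) : kmap h (kdiff t v) = kdiff t (kmap h v).
  by apply: IH => g x hg; apply: hZ; rewrite inE hg orbT.
rewrite kB IH' IH' kZ // => g hg; by rewrite inE hg orbT.
Qed.

Lemma kmap_scale (h : M -> N) r (y : kos fs M) :
  kmap h (r *: y) = kmap (fun x => h (r *: x)) y.
Proof. by elim: fs y => [|f gs IH] y //=; apply: injective_projections; apply: IH. Qed.

Lemma kmap_sum (I : Type) (r : seq I) (P : pred I) (c : I -> R) (g : I -> M -> N)
    (h : M -> N) (y : kos fs M) :
  (forall x, h x = \sum_(i <- r | P i) c i *: g i x) ->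
  kmap h y = \sum_(i <- r | P i) c i *: kmap (g i) y.
Proof.
move=> hE; elim: fs y => [|f gs IH] y //=; rewrite !IH.
apply: injective_projections => /=.
  by rewrite (big_morph (op1 := +%R) fst (id1 := 0)).
by rewrite (big_morph (op1 := +%R) snd (id1 := 0)).
Qed.

Lemma kmap_id (y : kos fs M) : kmap id y = y.
Proof. by elim: fs y => [|f gs IH] //= [a b] /=; rewrite !IH. Qed.

Lemma kmap_kall0 (p : M -> Prop) (h : M -> N) (y : kos fs M) :
  (forall x, p x -> h x = 0) -> kall p y -> kmap h y = 0.
Proof. by move=> hp; elim: fs y => [|f gs IH] y /= => [/hp|[/IH -> /IH ->]]. Qed.

Lemma kall_impl (p q : M -> Prop) (y : kos fs M) :
  (forall x, p x -> q x) -> kall p y -> kall q y.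
Proof.
move=> pq; elim: fs y => [|f gs IH] y /=; first exact: pq.
by move=> [/IH h1 /IH h2].
Qed.

End KoszulMaps.

Section Degree.
Variables (k : fieldType) (n : nat).
Local Notation R := {mpoly k[n]}.

Definition deg_le C : R^o -> Prop := fun x => (msize (x : R) <= C)%N.

Lemma kall_bounded fs (y : kos fs R^o) :
  exists C, @kall R fs R^o (deg_le C) y.
Proof.
elim: fs y => [|f fs IH] y /=; first by exists (msize (y : R)); apply: leqnn.
have [C hC] := IH y.1; have [D hD] := IH y.2; exists (C + D)%N; split.
  by apply: kall_impl hC => x h; rewrite /deg_le (leq_trans h) ?leq_addr.
by apply: kall_impl hD => x h; rewrite /deg_le (leq_trans h) ?leq_addl.
Qed.

Lemma msize_mulX u (f x : R) : (msize (f ^+ u * x) <= msize x + u * tdeg f)%N.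
Proof.
elim: u => [|u IH]; first by rewrite expr0 mul1r mul0n addn0.
rewrite exprS -mulrA; have [->|f0] := eqVneq f 0; first by rewrite mul0r msize0.
have [->|g0] := eqVneq (f ^+ u * x) 0; first by rewrite mulr0 msize0.
by rewrite msizeM // mulSn addnCA /tdeg (mpolySpred mdeg f0) addSn /= leq_add2l.
Qed.

(** Each entry is multiplied by [u]-th powers of some of the generators, each used at most once;
    this is where the sum of the degrees enters. *)
Lemma kall_trans u C fs (y : kos fs R^o) :
  @kall R fs R^o (deg_le C) y ->
  @kall R fs R^o (deg_le (C + u * \sum_(f <- fs) tdeg f)) (ktrans u y).
Proof.
elim: fs C y => [|f fs IH] C y /=; first by move=> h; rewrite /deg_le (leq_trans h) ?leq_addr.
move=> [/IH h1 /IH h2]; split.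
  apply: kall_impl h1 => x h; rewrite /deg_le big_cons (leq_trans h) // leq_add2l.
  by rewrite leq_mul2l leq_addl orbT.
set D := (C + _)%N in h2; have hD : (D + u * tdeg f = C + u * \sum_(g <- f :: fs) tdeg g)%N.
  by rewrite /D big_cons mulnDr -addnA; congr (_ + _)%N; rewrite addnC.
rewrite -hD; elim: (fs) (ktrans u y.2) h2 => [|g gs IHg] v /=.
  by move=> h; apply: leq_trans (msize_mulX _ _ _) _; rewrite leq_add2r.
by move=> [/IHg ? /IHg ?].
Qed.

End Degree.

(** * Coboundaries up to k[x_U]-torsion *)

Section TorsionModulo.
Variables (k : fieldType) (n : nat).
Local Notation R := {mpoly k[n]}.
Variables (q : nat) (U : {set 'I_n}) (fs : seq R) (Bd : kos fs R^o -> Prop).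
Hypothesis q_gt0 : (0 < q)%N.
Hypothesis Bd_lin : forall r y y', Bd y -> Bd y' -> Bd (r *: y + y').
Hypothesis Bd0 : Bd 0.
Hypothesis Bd_cpart : forall a y, box q U a -> Bd y ->
  Bd (kmap (cpart (dvd_off q U) a : R^o -> R^o) y).

(** Membership in [Bd] after inverting the nonzero elements of k[x_U]. *)
Let tors (y : kos fs R^o) := exists s, [/\ s \in mvars U, s != 0 & Bd (s *: y)].

Let tors_lin r y y' : tors y -> tors y' -> tors (r *: y + y').
Proof.
move=> [s [sU s0 sy]] [s' [sU' s0' sy']]; exists (s * s'); split.
- exact: rpredM.
- exact: mulf_neq0.
have -> : (s * s') *: (r *: y + y') = (s' * r) *: (s *: y) + s *: (s' *: y').
  by rewrite scalerDr !scalerA [s' * r * s]mulrC mulrA.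
by apply: Bd_lin => //; rewrite -[_ *: _]addr0; apply: Bd_lin.
Qed.

Let tors_Bd y : Bd y -> tors y.
Proof. by exists 1; rewrite rpred1 oner_neq0 scale1r. Qed.

Let tors_sum (I : Type) (r : seq I) (P : pred I) (c : I -> R) (F : I -> kos fs R^o) :
  (forall i, P i -> tors (F i)) -> tors (\sum_(i <- r | P i) c i *: F i).
Proof.
move=> hF; elim/big_rec: _ => [|i y Pi hy]; first exact: tors_Bd.
by apply: tors_lin => //; apply: hF.
Qed.

Let tors_cancel s y : s \in mvars U -> s != 0 -> tors (s *: y) -> tors y.
Proof.
move=> sU s0 [s' [sU' s0' sy']]; exists (s' * s).
by rewrite rpredM // mulf_neq0 // -scalerA.
Qed.

Local Notation part a := (cpart (dvd_off q U) a : R^o -> R^o).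

(* By descending induction on |a|: the component of index a + r_i U_(i) of
   h_i *: y, for h_i = \sum_j l i j * 'X_i ^+ j, is l i (r i) times the component
   of index a of y plus a combination of components of y of larger degree. *)
Lemma kos_torsion (r : 'I_n -> nat) (l : 'I_n -> nat -> R) (y : kos fs R^o) B :
  (forall i j, i \notin U -> l i j \in mvars U) ->
  (forall i, i \notin U -> l i (r i) != 0) ->
  (forall i, i \notin U -> Bd ((\sum_(j < (r i).+1) l i j * 'X_i ^+ j) *: y)) ->
  @kall R fs R^o (@deg_le k n B) y ->
  (forall a, box q U a -> (forall i, i \notin U -> (q <= a i + r i)%N) ->
    (B <= mdeg a)%N) ->
  exists s, [/\ s \in mvars U, s != 0 & Bd (s *: y)].
Proof.
move=> lU l0 lBd yB hB.
have boxdeg a : box q U a -> (mdeg a <= n * q)%N.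
  move=> /boxP[aU aq]; rewrite mdegE -[X in (X * q)%N]card_ord -sum_nat_const.
  apply: leq_sum => i _; have [/aU ->|/aq /ltnW] := boolP (i \in U) => //.
have claim N a : box q U a -> (n * q - mdeg a < N)%N -> tors (kmap (part a) y).
  elim: N a => // N IH a ba ltN.
  have [[i [iU lti]]|nex] := pselect (exists i, i \notin U /\ (a i + r i < q)%N); last first.
    (* No coordinate off [U] can be raised by [r i] inside the box, so [|a|] is at least [B] and
       this component vanishes. *)
    apply: tors_Bd; rewrite (kmap_kall0 _ yB) // => x xB; apply: cpart_deg.
    apply: leq_trans xB (hB _ ba _) => i iU; rewrite leqNgt; apply/negP => lt.
    by apply: nex; exists i.
  have [aU aq] := boxP _ _ _ ba.
  have shiftE j c : (a + U_(i) *+ j)%MM c = (a c + (i == c) * j)%N.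
    by rewrite mnmDE mulmnE mnm1E.
  have bb j : (j <= r i)%N -> box q U (a + U_(i) *+ j)%MM.
    move=> jr; apply/boxP; split=> c hc; rewrite shiftE.
      by case: eqP => [ic|_]; [rewrite ic hc in iU | rewrite aU].
    case: eqP => [<-|_]; last by rewrite addn0 aq.
    by rewrite mul1n (leq_ltn_trans _ lti) // leq_add2l.
  have subE j : (j <= r i)%N ->
      (a + U_(i) *+ r i - U_(i) *+ j = a + U_(i) *+ (r i - j))%MM.
    move=> jr; apply/mnmP => c; rewrite mnmBE !shiftE mulmnE mnm1E.
    by rewrite -addnBA ?leq_mul2l ?jr ?orbT // -mulnBr.
  have := Bd_cpart (bb _ (leqnn _)) (lBd i iU).
  rewrite kmap_scale (@kmap_sum R fs R^o R^o _ (index_enum 'I_(r i).+1) predT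
    (fun j => l i j) (fun j => part (a + U_(i) *+ (r i - j)%N)%MM)); last first.
    move=> x /=; rewrite /GRing.scale /= mulr_suml cpart_sum; apply: eq_bigr => j _.
    rewrite -mulrA cpart_semilinear ?bb //; last exact/mvars_mpow/lU.
    have jr : (j <= r i)%N by rewrite -ltnS.
    rewrite cpart_shift ?subE // shiftE eqxx mul1n.
    by apply: leq_trans jr (leq_addl _ _).
  rewrite big_ord_recr /= subnn mulm0n addm0 => /tors_Bd h.
  apply: (tors_cancel (lU i (r i) iU) (l0 _ iU)).
  suff ho : tors (\sum_(j < r i) l i j *: kmap (part (a + U_(i) *+ (r i - j))%MM) y).
    by have := tors_lin (-1) ho h; rewrite scaleN1r addKr.
  apply: tors_sum => j _; apply: IH; first by rewrite bb ?leq_subr.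
  have dj : (mdeg a < mdeg (a + U_(i) *+ (r i - j)))%N.
    by rewrite mdegD mdegMn mdeg1 mul1n -[X in (X < _)%N]addn0 ltn_add2l subn_gt0.
  rewrite -ltnS; apply: leq_trans ltN; rewrite ltnS ltn_sub2l //.
  by apply: leq_trans dj _; rewrite boxdeg ?bb ?leq_subr.
suff : tors y by [].
rewrite -[y]kmap_id (@kmap_sum R fs R^o R^o _ (index_enum 'X_{1..n < (n * q).+1})
  (fun a => box q U a) (fun a => 'X_[a]) (fun a => part a)).
  by apply: tors_sum => a ba; apply: (claim (n * q - mdeg a).+1).
by move=> x; apply: cpart_decomp.
Qed.

End TorsionModulo.

(** * Chains of primes *)

Section PrimeAvoiding.
Variable R : comNzRingType.

Definition prime_of (Q : {pred R}) (Q0 : 0 \in Q) (Q1 : 1 \notin Q)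
    (QP : forall a, {in Q &, forall u v, a * u + v \in Q})
    (QM : prime_idealr_closed Q) : prime_idealr R :=
  HB.pack_for (prime_idealr R) Q
    (isIdealr.Build R Q (And3 Q0 Q1 QP)) (isPrimeIdealrClosed.Build R Q QM).

(** An ideal maximal among those containing [J] and disjoint from the multiplicative set [S] is
    prime. *)
Lemma prime_avoiding (J S : R -> Prop) : J 0 ->
  (forall a x y, J x -> J y -> J (a * x + y)) ->
  S 1 -> (forall x y, S x -> S y -> S (x * y)) -> (forall x, S x -> ~ J x) ->
  exists Q : prime_idealr R,
    (forall x, J x -> x \in Q) /\ (forall x, S x -> x \notin Q).
Proof.
move=> J0 JP S1 SM SJ.
pose good (A : R -> Prop) := [/\ forall x, J x -> A x,
  forall a x y, A x -> A y -> A (a * x + y) & forall x, S x -> ~ A x].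
pose P (A : R -> Prop) := (forall x, ~ A x) \/ good A.
have [F FP Ftot|A [PA Amax]] := @classical_sets.Zorn_bigcup R P.
  have [[X [FX gX]]|nX] := pselect (exists X, F X /\ good X); last first.
    left=> x [X FX Xx]; have [/(_ x)//|gX] := FP _ FX.
    by apply: nX; exists X.
  have [JX _ _] := gX; right; split=> [x /JX|a x y [Y FY Yx] [Z FZ Zy]|x Sx [Y FY Yx]].
  - by exists X.
  - have [YZ|ZY] := Ftot _ _ FY FZ.
      exists Z => //; have [/(_ y)//|[_ ZP _]] := FP _ FZ.
      by apply: ZP => //; apply: YZ.
    exists Y => //; have [/(_ x)//|[_ YP _]] := FP _ FY.
    by apply: YP => //; apply: ZY.
  - by have [/(_ x)//|[_ _ YS]] := FP _ FY; apply: YS Yx.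
have gJ : good J by split.
have [JA AP SA] : good A.
  case: PA => // A0; case: (Amax J); last by right.
  by split=> [x /A0 //|/(_ 0 J0) /A0].
(* By maximality, adjoining an element outside [A] produces an ideal that meets [S]. *)
have maxA x : ~ A x -> exists2 a, A a & exists c, S (c * x + a).
  move=> nAx; apply: contrapT => nex.
  pose B y := exists2 a, A a & exists c, y = c * x + a.
  case: (Amax B); first split.
  - by move=> a Aa; exists a => //; exists 0; rewrite mul0r add0r.
  - move=> BA; apply/nAx/BA; exists 0; first exact: JA.
    by exists 1; rewrite mul1r addr0.
  right; split=> [y /JA Ay|d y z [a Aa [c ->]] [a' Aa' [c' ->]]|y Sy [a Aa [c ey]]].
  - by exists y => //; exists 0; rewrite mul0r add0r.
  - exists (d * a + a'); first exact: AP.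
    by exists (d * c + c'); rewrite mulrDr addrACA mulrA -mulrDl.
  - by apply: nex; exists a => //; exists c; rewrite -ey.
have AZ a x : A x -> A (a * x).
  by move=> Ax; rewrite -[_ * _]addr0; apply: AP => //; apply: JA.
pose Q : {pred R} := fun x => `[< A x >].
have Q0 : 0 \in Q by apply/asboolP/JA.
have Q1 : 1 \notin Q by apply/asboolP/SA.
have QP a : {in Q &, forall u v, a * u + v \in Q}.
  by move=> u v /asboolP Au /asboolP Av; apply/asboolP; apply: AP.
have QM : prime_idealr_closed Q.
  move=> x y /asboolP Axy; apply/orP.
  have [Ax|/maxA[a Aa [c Sx]]] := pselect (A x); first by left; apply/asboolP.
  have [Ay|/maxA[b Ab [d Sy]]] := pselect (A y); first by right; apply/asboolP.
  case: (SA _ (SM _ _ Sx Sy)).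
  have -> : (c * x + a) * (d * y + b) =
      (c * d) * (x * y) + ((c * x) * b + (d * y + b) * a).
    by rewrite mulrDl mulrDr -addrA mulrACA [a * _]mulrC.
  by apply: (AP) => //; apply: (AP) => //; apply: AZ.
exists (prime_of Q0 Q1 QP QM); split=> x; first by move=> /JA ?; apply/asboolP.
by move=> /SA ?; apply/asboolP.
Qed.

End PrimeAvoiding.

(** * Independent sets of variables modulo a prime *)

Section Independence.
Variables (k : fieldType) (n : nat).
Local Notation R := {mpoly k[n]}.
Implicit Types (U : {set 'I_n}) (P : prime_idealr R).

(** Equivalently, the residues of the variables x_U modulo [P] are algebraically independent over
    [k]. *)
Definition indep P U := forall f : R, f \in mvars U -> f \in P -> f = 0.

Lemma poly_in_var U i (f : R) : f \in mvars (i |: U) -> f != 0 ->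
  exists r (l : nat -> R), [/\ forall j, l j \in mvars U, l r != 0 &
    f = \sum_(j < r.+1) l j * 'X_i ^+ j].
Proof.
move=> /mono_inP fU f0.
(* Keeping only exponents free of [i] after the shift by [U_(i) *+ j] extracts the coefficient of
   ['X_i ^+ j]. *)
pose l j := cpart (fun m : 'X_{1..n} => m i == 0%N) (U_(i) *+ j)%MM f.
have lU j : l j \in mvars U.
  apply/mono_inP => w; rewrite cpartE; case: ifP => [/eqP wi|]; last by rewrite eqxx.
  move=> /fU /vars_inP h; apply/vars_inP => c cU.
  have [->//|ci] := eqVneq c i.
  by have := h c; rewrite !inE negb_or ci cU mnmDE => /(_ isT) /eqP; rewrite addn_eq0 => /andP[/eqP].
have : exists N, f == \sum_(j < N) l j * 'X_i ^+ j.
  exists (msize f); apply/eqP/mpolyP => w; rewrite raddf_sum /=.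
  have termE j : (l j * 'X_i ^+ j)@_w = if w i == j then f@_w else 0.
    rewrite mulrC mpolyXn mcoeffXM cpartE mnmBE mulmnE mnm1E eqxx mul1n subn_eq0.
    have [le|nle] := boolP (U_(i) *+ j <= w)%MM.
      have jw : (j <= w i)%N by have := mnm_lepP le i; rewrite mulmnE mnm1E eqxx mul1n.
      by rewrite submK // eqn_leq jw andbT.
    case: eqP => // wij; case/negP: nle; apply/mnm_lepP => c.
    by rewrite mulmnE mnm1E; case: eqP => // <-; rewrite mul1n wij.
  under eq_bigr do rewrite termE.
  have [lt|ge] := ltnP (w i) (msize f).
    rewrite (bigD1 (Ordinal lt)) //= eqxx big1 ?addr0 // => j.
    by rewrite -val_eqE /= eq_sym => /negbTE ->.
  rewrite memN_msupp_eq0 ?big1 // => [j _|]; first by rewrite if_same.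
  by apply: msize_mdeg_ge; rewrite (leq_trans ge) // mdegE (bigD1 i) //= leq_addr.
(* Taking the least number of terms forces the top coefficient to be nonzero. *)
case/ex_minnP => -[|r] /eqP ef minN.
  by move: f0; rewrite ef big_ord0 eqxx.
exists r, l; split=> //; apply/eqP => lr0.
by have := minN r; rewrite {1}ef big_ord_recr /= lr0 mul0r addr0 eqxx ltnn => /(_ isT).
Qed.

Lemma dependent_relation P U i : ~ indep P (i |: U) ->
  exists r (l : nat -> R), [/\ forall j, l j \in mvars U, l r != 0 &
    \sum_(j < r.+1) l j * 'X_i ^+ j \in P].
Proof.
move=> nind; have [f [fU fP f0]] : exists f : R, [/\ f \in mvars (i |: U), f \in P & f != 0].
  apply: contrapT => nex; apply: nind => f fU fP; apply/eqP/negPn/negP => f0.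
  by apply: nex; exists f.
by have [r [l [lU lr ef]]] := poly_in_var fU f0; exists r, l; rewrite -ef.
Qed.

End Independence.

Lemma ideal_quot_eq0 (R : comNzRingType) (P : prime_idealr R) (x : R) :
  (\pi_{ideal_quot P} x == 0) = (x \in P).
Proof. by rewrite -[x in RHS]subr0 Quotient.idealrBE raddf0. Qed.

Lemma rmorph_sum_expr (A B : comNzRingType) (h : {rmorphism A -> B}) d
    (a b : 'I_d -> A) (y z : A) : h y = h z ->
  h (\sum_(j < d) a j * y ^+ j * b j) = h (\sum_(j < d) a j * z ^+ j * b j).
Proof.
by move=> e; rewrite !rmorph_sum; apply: eq_bigr => j _; rewrite !rmorphM !rmorphXn e.
Qed.

Section Chain.
Variables (k : fieldType) (n : nat).
Local Notation R := {mpoly k[n]}.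
Implicit Types (U : {set 'I_n}) (P Q : prime_idealr R).

Definition restrict U : R -> R :=
  mmap (@mpolyC n k) (fun i => if i \in U then 'X_i else 0).
HB.instance Definition _ U := GRing.RMorphism.on (restrict U).

Lemma restrict_mvars U f : restrict U f \in mvars U.
Proof.
apply: rpred_sum => m _; apply: rpredM; first exact: mvarsC.
apply: rpred_prod => i _; apply: rpredX; by case: ifP => [iU|_]; [exact: mvarsX|exact: rpred0].
Qed.

Lemma restrict_id U f : f \in mvars U -> restrict U f = f.
Proof.
move=> /allP fU; rewrite [RHS]mpolyE /restrict /mmap big_seq [RHS]big_seq.
apply: eq_bigr => m /fU /vars_inP h; rewrite mul_mpolyC mpolyXE_id; congr (_ *: _).
apply: eq_bigr => i _; case: ifPn => // /h ->; by rewrite !expr0.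
Qed.

Lemma mlead_mvars U (f : R) i : f \in mvars U -> i \notin U -> mlead f i = 0%N.
Proof.
move=> /allP fU iU; have [->|f0] := eqVneq f 0; first by rewrite mlead0 mnm0E.
by have /vars_inP -> := fU _ (mlead_supp f0).
Qed.

Lemma dvd_one_plus_expr (A : comNzRingType) (w : A) m :
  exists c, w ^+ m = (-1) ^+ m + (1 + w) * c.
Proof.
elim: m => [|m [c IH]]; first by exists 0; rewrite mulr0 addr0.
exists (w * c + (-1) ^+ m).
by rewrite !exprS IH; ring.
Qed.


Lemma mlead_one_plus (L : R) u : L != 0 ->
  mlead (1 + 'X_u * L) = (U_(u) + mlead L)%MM.
Proof.
move=> L0; have X0 : 'X_u != 0 :> R by rewrite -msize_poly_eq0 msizeX.
have lXL : mlead ('X_u * L) = (U_(u) + mlead L)%MM by rewrite mleadM ?mleadXm.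
by rewrite mleadDr lXL // mlead1 lt_mdeg_ltmc // mdeg0 mdegD mdeg1.
Qed.

Lemma dependent_relations P U : (forall i, i \notin U -> ~ indep P (i |: U)) ->
  exists (r : 'I_n -> nat) (l : 'I_n -> nat -> R), forall i, i \notin U ->
    [/\ forall j, l i j \in mvars U, l i (r i) != 0 &
      \sum_(j < (r i).+1) l i j * 'X_i ^+ j \in P].
Proof.
move=> mU.
have rel i : exists rl : nat * (nat -> R), i \notin U ->
    [/\ forall j, rl.2 j \in mvars U, rl.2 rl.1 != 0 &
      \sum_(j < rl.1.+1) rl.2 j * 'X_i ^+ j \in P].
  have [iU|/mU/dependent_relation[r [l h]]] := boolP (i \in U).
    by exists (0%N, fun=> 0).
  by exists (r, l).
have [rl rlP] := choice rel.
by exists (fun i => (rl i).1), (fun i => (rl i).2).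
Qed.

Section Step.
Variables (P : prime_idealr R) (U : {set 'I_n}).
Local Notation B := {ideal_quot P}.
Hypothesis indepU : indep P U.
Hypothesis maxU : forall i, i \notin U -> ~ indep P (i |: U).

(** Since [restrict U] is a retraction of [R] onto k[x_U], integrality over [phi] is integrality
    over the image of k[x_U] in [B]. *)
Let phi : {rmorphism R -> B} := \pi_B \o restrict U.
Let intg (z : R) := integralOver phi (\pi_B z).

Let intg_monic (p : {poly R}) z : p \is monic ->
  (forall j, p`_j \in mvars U) -> p.[z] \in P -> intg z.
Proof.
move=> mp pU pz; exists p => //.
have -> : map_poly phi p = map_poly \pi_B p.
  by apply/polyP => j; rewrite !coef_map /= restrict_id.
by rewrite rootE horner_map ideal_quot_eq0.
Qed.

Let intg_poly z : intg z -> exists2 p : {poly R}, p \is monic &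
  (forall j, p`_j \in mvars U) /\ p.[z] \in P.
Proof.
move=> [p mp pz]; exists (map_poly (restrict U) p); first exact: monic_map.
split=> [j|]; first by rewrite coef_map restrict_mvars.
by rewrite -ideal_quot_eq0 -horner_map -map_poly_comp -rootE.
Qed.

Let intg_mvars z : z \in mvars U -> intg z.
Proof.
move=> zU; rewrite /intg -(restrict_id zU); exact: (integral_id phi).
Qed.

Let intgM y z : intg y -> intg z -> intg (y * z).
Proof. by rewrite /intg rmorphM; apply: integral_mul. Qed.

Let intgX z m : intg z -> intg (z ^+ m).
Proof.
move=> hz; elim: m => [|m IH]; first by apply: intg_mvars; apply: rpred1.
by rewrite exprS; apply: intgM.
Qed.

(** If the relation of x_i has degree [r.+1] and top coefficient [c i], multiplying it by [c i ^+ r]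
    makes it monic in [c i * 'X_i]. The product of the [c i] is a common denominator. *)
Lemma integral_denominator : exists L : R, [/\ L \in mvars U, L != 0 &
  forall i, intg (L * 'X_i)].
Proof.
have [rr [ll rlP]] := dependent_relations maxU.
pose c i := ll i (rr i).
have intc i : i \notin U -> intg (c i * 'X_i).
  move=> iU; have [lU cnz relP] := rlP i iU.
  rewrite /c; move: (rr i) (ll i) lU cnz relP => r l lU lr0 relP.
  case: r => [|r] in lr0 relP *.
    (* A relation of degree 0 would be a nonzero element of k[x_U] in [P]. *)
    move: relP; rewrite big_ord1 expr0 mulr1 => /(indepU (lU _)) l0.
    by rewrite l0 eqxx in lr0.
  pose p0 : {poly R} := \poly_(j < r.+1) (l j * l r.+1 ^+ (r - j)).
  pose p : {poly R} := 'X^(r.+1) + p0.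
  have szp : (size p0 < size ('X^(r.+1) : {poly R}))%N.
    by rewrite size_polyXn ltnS size_poly.
  apply: (@intg_monic p).
  - by rewrite monicE /p lead_coefDl // lead_coefXn.
  - move=> j; rewrite coefD coefXn coef_poly rpredD ?rpred_nat //.
    by case: ifP => _; [rewrite rpredM ?rpredX | rewrite rpred0].
  rewrite /p /p0 hornerD hornerXn horner_poly.
  have -> : (l r.+1 * 'X_i) ^+ r.+1 +
      \sum_(j < r.+1) l j * l r.+1 ^+ (r - j) * (l r.+1 * 'X_i) ^+ j =
      l r.+1 ^+ r * \sum_(j < r.+2) l j * 'X_i ^+ j.
    rewrite [in RHS]big_ord_recr /= mulrDr addrC mulr_sumr; congr (_ + _).
      apply: eq_bigr => j _; have jr : (j <= r)%N by rewrite -ltnS.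
      have -> : l r.+1 ^+ r = l r.+1 ^+ (r - j) * l r.+1 ^+ j.
        by rewrite -exprD subnK.
      by rewrite exprMn; ring.
    by rewrite exprMn exprS; ring.
  by rewrite idealMr.
pose L := \prod_(i | i \notin U) c i.
have LU : L \in mvars U by apply: rpred_prod => i /rlP[lU _ _]; apply: lU.
exists L; split=> // [|i].
  by apply/prodf_neq0 => i /rlP[].
have [iU|iU] := boolP (i \in U).
  by apply: intg_mvars; rewrite rpredM // mvarsX.
rewrite /L (bigD1 i) //= mulrAC; apply: intgM; first exact: intc.
by apply: intg_mvars; apply: rpred_prod => j /andP[/rlP[lU _ _] _]; apply: lU.
Qed.

(** The exponent [msize b] exceeds the degree of each monomial of [b], so every variable in it
    receives its own factor [L]. *)
Lemma integral_clear (L b : R) : L \in mvars U -> (forall i, intg (L * 'X_i)) ->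
  exists N, intg (L ^+ N * b).
Proof.
move=> LU intL; exists (msize b); rewrite {2}(mpolyE b) mulr_sumr big_seq.
rewrite /intg raddf_sum; apply: big_ind => [|x y|m mb].
- exact: integral0.
- exact: integral_add.
have le : (mdeg m <= msize b)%N by rewrite ltnW // msize_mdeg_lt.
rewrite -/(intg _) -mul_mpolyC mulrCA; apply: intgM; first exact/intg_mvars/mvarsC.
have -> : L ^+ msize b * 'X_[m] =
    L ^+ (msize b - mdeg m) * \prod_i (L * 'X_i) ^+ m i.
  under [in RHS]eq_bigr do rewrite exprMn.
  rewrite big_split /= -mpolyXE_id mulrA -expr_sum -exprD -mdegE subnK //.
apply: intgM; first exact/intgX/intg_mvars.
by rewrite /intg rmorph_prod; apply: big_ind => [|x y|i _];
  [exact: integral1|exact: integral_mul|exact: intgX].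
Qed.

(* Integrality over k[x_U] of L ^+ N * b turns b * u0 = s, for u0 := 1 + 'X_u * L,
   into divisibility by u0 of a power of L ^+ N * s in R; as u0 is coprime to L,
   it divides a power of s, in which the variable 'X_u does not occur. *)
Lemma no_inverse_mod (L : R) u b s : L \in mvars U -> L != 0 ->
  (forall i, intg (L * 'X_i)) -> u \in U -> s \in mvars (U :\ u) -> s != 0 ->
  b * (1 + 'X_u * L) - s \in P -> False.
Proof.
move=> LU L0 intL uU sU s0 bs; set u0 := 1 + _ in bs.
have u0U : u0 \in mvars U by rewrite rpredD ?rpred1 // rpredM // mvarsX.
have sU' : s \in mvars U by apply: mvarsS sU; apply: subD1set.
have [N /intg_poly[p mp [pU pz]]] := integral_clear b LU intL.
set z := L ^+ N * b in pz; set d := (size p).-1.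
have szp : size p = d.+1 by rewrite /d prednK // size_poly_gt0 monic_neq0.
(* This is [u0 ^+ d * p.[z]] with [z * u0] replaced by [L ^+ N * s], congruent to it modulo [P]. So
   [Y] lies in both [P] and k[x_U], hence is zero, and [u0] divides its top term. *)
pose Y := \sum_(j < d.+1) p`_j * (L ^+ N * s) ^+ j * u0 ^+ (d - j).
have YP : Y \in P.
  have e1 : \sum_(j < d.+1) p`_j * (z * u0) ^+ j * u0 ^+ (d - j) = u0 ^+ d * p.[z].
    rewrite horner_coef szp mulr_sumr; apply: eq_bigr => j _.
    have jd : (j <= d)%N by rewrite -ltnS.
    have -> : u0 ^+ d = u0 ^+ (d - j) * u0 ^+ j by rewrite -exprD subnK.
    by rewrite exprMn; ring.
  have e2 : \pi_B (z * u0) = \pi_B (L ^+ N * s).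
    apply/eqP; rewrite -subr_eq0 -rmorphB ideal_quot_eq0 /z -mulrA -mulrBr.
    by rewrite idealMr.
  rewrite -ideal_quot_eq0.
  have -> : \pi_B Y = \pi_B (u0 ^+ d * p.[z]).
    by rewrite -e1; apply/esym/rmorph_sum_expr.
  by rewrite ideal_quot_eq0 idealMr.
have YU : Y \in mvars U.
  by apply: rpred_sum => j _; rewrite !rpredM ?rpredX // rpredM // rpredX.
have := indepU YU YP; rewrite /Y big_ord_recr /= subnn expr0 mulr1.
have -> : p`_d = 1 by rewrite /d -lead_coefE (monicP mp).
rewrite mul1r => /eqP; rewrite addr_eq0 => /eqP e.
have [V eV] : exists V, (L ^+ N * s) ^+ d = u0 * V.
  exists (- \sum_(j < d) p`_j * (L ^+ N * s) ^+ j * u0 ^+ (d - j).-1).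
  rewrite mulrN mulr_sumr -[LHS]opprK -e; congr (- _); apply: eq_bigr => j _.
  have -> : u0 ^+ (d - j) = u0 * u0 ^+ (d - j).-1.
    by rewrite -exprS prednK ?subn_gt0.
  by ring.
have [c ec] := dvd_one_plus_expr ('X_u * L) (N * d).
(* Multiplying by ['X_u ^+ (N * d)] removes [L], because ['X_u * L] is -1 modulo [u0]. *)
have [V' eV'] : exists V', s ^+ d = u0 * V'.
  exists ((-1) ^+ (N * d) * ('X_u ^+ (N * d) * V - c * s ^+ d)).
  have -> : u0 * ((-1) ^+ (N * d) * ('X_u ^+ (N * d) * V - c * s ^+ d)) =
      (-1) ^+ (N * d) * ('X_u ^+ (N * d) * (u0 * V) - u0 * c * s ^+ d) by ring.
  rewrite -eV exprMn -exprM mulrA -exprMn ec -/u0 -mulrBl addrK mulrA -exprMn.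
  by rewrite mulrNN mul1r expr1n mul1r.
(* The variable ['X_u] divides the leading monomial of [u0], but it does not occur in [s ^+ d]. *)
have : u0 * V' != 0 by rewrite -eV' expf_neq0.
rewrite mulf_eq0 negb_or => /andP[w0 V0].
have sdU : s ^+ d \in mvars (U :\ u) by rewrite rpredX.
have := mlead_mvars (i := u) sdU; rewrite !inE eqxx /= => /(_ isT).
by rewrite eV' mleadM // mlead_one_plus // !mnmDE mnm1E eqxx.
Qed.

End Step.

(** [Q] contains [P] and [u0] and avoids the nonzero elements of k[x_(U minus u)]; [no_inverse_mod]
    makes this possible. It is strictly larger than [P] since [u0] is a nonzero element of
    k[x_U]. *)
Lemma prime_step P U u : indep P U ->
  (forall i, i \notin U -> ~ indep P (i |: U)) -> u \in U ->
  exists Q : prime_idealr R, [/\ {subset P <= Q}, ~ {subset Q <= P} &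
    indep Q (U :\ u)].
Proof.
move=> iU mU uU; have [L [LU L0 intL]] := integral_denominator iU mU.
pose u0 := 1 + 'X_u * L : R.
have u00 : u0 != 0.
  apply/eqP => e; have := congr1 (fun f => mlead f u) e.
  by rewrite /= /u0 mlead_one_plus // mlead0 mnmDE mnm1E eqxx mnm0E.
have u0U : u0 \in mvars U by rewrite rpredD ?rpred1 // rpredM // mvarsX.
have [|a x y [c xc] [d yd]|||s [sU s0]|Q [JQ SQ]] := @prime_avoiding R
  (fun x => exists c, x - c * u0 \in P)
  (fun s => s \in mvars (U :\ u) /\ s != 0).
- by exists 0; rewrite mul0r subr0 rpred0.
- exists (a * c + d).
  have -> : a * x + y - (a * c + d) * u0 = a * (x - c * u0) + (y - d * u0) by ring.
  by rewrite rpredD // idealMr.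
- by rewrite rpred1 oner_neq0.
- by move=> x y [? ?] [? ?]; rewrite rpredM // mulf_neq0.
- move=> [c hc]; apply: (no_inverse_mod iU LU L0 intL uU sU s0 (b := c)).
  by rewrite -opprB rpredN.
exists Q; split.
- by move=> x xP; apply: JQ; exists 0; rewrite mul0r subr0.
- move=> QP; have : u0 \in Q by apply: JQ; exists 1; rewrite mul1r subrr rpred0.
  by move=> /QP /(iU _ u0U) e; rewrite e eqxx in u00.
move=> x xU xQ; apply/eqP/negPn/negP => x0.
by have := SQ x (conj xU x0); rewrite xQ.
Qed.

Lemma indep_maximal P U : indep P U -> exists V : {set 'I_n}, [/\ U \subset V,
  indep P V & forall i, i \notin V -> ~ indep P (i |: V)].
Proof.
move=> iU; have [V /maxsetP[/asboolP iV maxV] UV] :=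
  @maxset_exists _ (fun V => `[< indep P V >]) U (asboolT iU).
exists V; split=> // i iNV iiV; have := maxV (i |: V) (asboolT iiV) (subsetUr _ _).
by move/setP/(_ i); rewrite !inE eqxx (negbTE iNV).
Qed.

(** Each step costs one variable. The remaining set may fail to be maximal for the new prime, so it
    is enlarged again before the next step. *)
Lemma prime_chain c P U : indep P U -> (c <= #|U|)%N ->
  exists Q : nat -> prime_idealr R, {subset P <= Q 0%N} /\
    forall i, (i < c)%N -> {subset Q i <= Q i.+1} /\ ~ {subset Q i.+1 <= Q i}.
Proof.
elim: c P U => [|c IH] P U iU cU; first by exists (fun=> P); split=> //.
have [V [UV iV mV]] := indep_maximal iU.
have cV : (c < #|V|)%N by apply: leq_trans cU (subset_leq_card UV).
have /card_gt0P[u uV] : (0 < #|V|)%N by apply: leq_trans cV.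
have [P' [PP' nPP' iP']] := prime_step iV mV uV.
have [|Q [P'Q Qc]] := IH _ _ iP'; first by rewrite (cardsD1 u) uV in cV.
exists (fun i => if i is j.+1 then Q j else P); split=> // -[|i] ic; last exact: Qc.
split; first by move=> x /PP'/P'Q.
by move=> QP; apply: nPP' => x /P'Q/QP.
Qed.

Lemma krull_dim_ge_indep P U : indep P U -> krull_dim_ge {ideal_quot P} #|U|.
Proof.
move=> iU; have [Q [PQ0 QS]] := prime_chain iU (leqnn _).
have Qle i j : (i <= j)%N -> (j <= #|U|)%N -> {subset Q i <= Q j}.
  move=> /subnKC <-; elim: (j - i)%N => [|d IH]; first by rewrite addn0 => _ x.
  rewrite addnS => h x /(IH (ltnW h)) hx; exact: (QS _ h).1 _ hx.
have PQ i : (i <= #|U|)%N -> {subset P <= Q i}.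
  by move=> h x /PQ0; apply: Qle.
(* The image of [Q i] in the quotient; testing it on representatives is legitimate because [P] is
   contained in [Q i]. *)
pose q i : {pred {ideal_quot P}} := fun x => repr x \in Q i.
have qE i x : (i <= #|U|)%N -> (\pi_{ideal_quot P} x \in q i) = (x \in Q i).
  move=> h; rewrite -[LHS]/(repr _ \in Q i).
  have hx : repr (\pi_{ideal_quot P} x) - x \in Q i.
    by apply: (PQ _ h); rewrite Quotient.idealrBE reprK.
  by rewrite -[repr _](subrK x) rpredDl.
have [T hT] : exists T : nat -> prime_idealr {ideal_quot P},
    forall i x, (i <= #|U|)%N -> (\pi_{ideal_quot P} x \in T i) = (x \in Q i).
  have ex i : exists T : prime_idealr {ideal_quot P}, (i <= #|U|)%N ->
      forall x, (\pi_{ideal_quot P} x \in T) = (x \in Q i).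
    (* Indices beyond the chain receive the prime of index 0 as a default. *)
    have [i0 [h ei]] : exists i0, (i0 <= #|U|)%N /\ ((i <= #|U|)%N -> i = i0).
      by have [h|_] := boolP (i <= #|U|)%N; [exists i | exists 0].
    suff [T hT] : exists T : prime_idealr {ideal_quot P},
        forall x, (\pi_{ideal_quot P} x \in T) = (x \in Q i0).
      by exists T => /ei ->.
    move: (i0) h => {i i0 ei} i h.
    have q0 : 0 \in q i by rewrite -(raddf0 \pi_{ideal_quot P}) qE // rpred0.
    have q1 : 1 \notin q i by rewrite -(rmorph1 \pi_{ideal_quot P}) qE // idealr1.
    have qP a : {in q i &, forall u v, a * u + v \in q i}.
      move=> u v; rewrite -[u]reprK -[v]reprK -[a]reprK -rmorphM -rmorphD !qE //.
      by move=> hu hv; rewrite rpredD // idealMr.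
    have qM : prime_idealr_closed (q i).
      move=> u v; rewrite -[u]reprK -[v]reprK -rmorphM !qE //.
      by rewrite prime_idealrM.
    by exists (prime_of q0 q1 qP qM) => x; apply: qE.
  by have [T hT] := choice ex; exists T => i x h; apply: hT.
exists #|U| => //; exists (fun i => T i) => i j ij.
have [hi hj] : (i <= #|U|)%N /\ (j <= #|U|)%N by split; rewrite -ltnS ltn_ord.
split=> [x|TT]; first by rewrite -[x]reprK !hT //; apply/Qle/hj/ltnW.
have ilt : (i < #|U|)%N by apply: leq_trans ij hj.
apply: (QS _ ilt).2 => x hx; rewrite -hT // TT // hT //.
exact: (Qle i.+1).
Qed.

End Chain.

(** * Associated primes of local cohomology *)

Section KoszulComponents.
Variables (k : fieldType) (n : nat).
Local Notation R := {mpoly k[n]}.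

(** Elements of [mvars set0] are constants, and a nonzero constant is a unit. *)
Lemma indep_set0 (P : prime_idealr R) : indep P set0.
Proof.
move=> f /mono_inP f0 fP.
have fC : f = (f@_0%MM)%:MP.
  apply/mpolyP => m; rewrite mcoeffC; case: eqP => [->|m0]; first by rewrite mulr1.
  rewrite mulr0; apply/eqP/negPn/negP => /f0 /vars_inP h; apply: m0.
  by apply/mnmP => i; rewrite h ?inE // mnm0E.
rewrite fC in fP *; have [->|c0] := eqVneq f@_0%MM 0; first exact: mpolyC0.
have := idealMr (f@_0%MM)^-1%:MP fP.
by rewrite -mpolyCM mulVf // mpolyC1 idealr1.
Qed.

(** A component of a coboundary is the coboundary of the component of its primitive, by linearity of
    the differential over [mpow (p ^ e) U]. *)
Lemma kcob_cpart p e (U : {set 'I_n}) (fs : seq R) i a (y : kos fs R^o) :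
  p \in [pchar k] -> box (p ^ e) U a -> kcob (p ^ e) i y ->
  kcob (p ^ e) i (kmap (cpart (dvd_off (p ^ e) U) a : R^o -> R^o) y).
Proof.
move=> pk ba; have c0 := @cpart0 k n (dvd_off (p ^ e) U) a.
case: i => [|i] /=.
  by move=> ->; apply: (kmap_kall0 (p := fun x => x = 0)) => [x ->//|]; elim: (fs).
move=> [h hh ->]; exists (kmap (cpart (dvd_off (p ^ e) U) a : R^o -> R^o) h).
  exact: khom_map.
apply: kmap_diff_semi => [x y'|f x _]; first exact: cpartB.
exact: (cpart_semilinear _ ba (frobenius_mpow _ _ _ pk)).
Qed.

Lemma kcob_lin (A : comNzRingType) (fs : seq A) (M : lmodType A) t i r
    (y y' : kos fs M) : kcob t i y -> kcob t i y' -> kcob t i (r *: y + y').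
Proof.
case: i => [|i] /=; first by move=> -> ->; rewrite scaler0 addr0.
move=> [h hh ->] [h' hh' ->]; exists (r *: h + h'); first exact: khomP.
by rewrite linearP.
Qed.

Lemma kcob0 (A : comNzRingType) (fs : seq A) (M : lmodType A) t i :
  kcob t i (0 : kos fs M).
Proof.
by case: i => [|i] //=; exists 0; rewrite ?linear0 //; apply: khom0.
Qed.

End KoszulComponents.

Theorem theorem1 (k : fieldType) (p : nat) (n s : nat)
    (f : 'I_s -> {mpoly k[n]}) (i : nat)
    (E : injective_resolution {mpoly k[n]}^o)
    (P : prime_idealr {mpoly k[n]}) :
  p \in [pchar k] ->
  (\sum_(j < s) tdeg (f j) < n)%N ->
  associated_prime (local_cohomology (ideal_gen f) E i) P ->
  krull_dim_ge {ideal_quot P} (n - \sum_(j < s) tdeg (f j))%N.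
Proof.
move=> pk _ [z zP]; set d := (\sum_(j < s) _)%N.
have [V [_ iV mV]] := indep_maximal (@indep_set0 k n P).
have [l le_l [Q QS]] := krull_dim_ge_indep iV.
(* It remains to show that a maximal independent set has at least [n - d] elements. *)
suff le_nd : (n - d <= #|V|)%N by exists l; [apply: leq_trans le_l | exists Q].
rewrite leqNgt; apply/negP => ltV.
have [r [lc rel]] := dependent_relations mV.
have [t [g [gP Pg]]] := local_cohomology_koszul z (@mpoly_colon_stable k n).
(* The relation of x_c lies in [P] and so kills [z]; for [c] in [V] the bound 0 is a default. *)
have u0E c : exists m, c \notin V -> forall u, (m <= u)%N ->
    kcob (t + u) i ((\sum_(j < (r c).+1) lc c j * 'X_c ^+ j) *: ktrans u g).
  have [_|cV] := boolP (c \in V); first by exists 0%N.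
  have [_ _ relP] := rel c cV.
  by move: relP; rewrite zP => /eqP/gP[m hm]; exists m.
have [u0 u0P] := choice u0E.
have [C gC] := kall_bounded g.
(* [e] exceeds every constant that has to be small against [q], and [e < p ^ e = q]. *)
pose e := (t + \sum_c u0 c + C + \sum_c r c).+1.
pose q := (p ^ e)%N; pose u := (q - t)%N.
have ltq : (e < q)%N by apply: ltn_expl; apply: prime_gt1 (pcharf_prime pk).
have tq : (t + u = q)%N.
  by rewrite subnKC // (leq_trans _ (ltnW ltq)) // /e -!addnA leqW ?leq_addr.
have le_u c : (u0 c <= u)%N.
  rewrite -(leq_add2l t) tq (leq_trans _ (ltnW ltq)) // /e -addnA -addnA.
  by rewrite leqW // leq_add2l (bigD1 c) //= -addnA leq_addr.
have ds : (\sum_(h <- codom f) tdeg h = d)%N by rewrite /d big_image.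
have [|||||||||s0 [sV s0nz sB]] :=
  @kos_torsion k n q V (codom f) (fun y => kcob q i y) _ _ _ _ r lc (ktrans u g)
  (C + u * d).
- by rewrite (leq_ltn_trans _ ltq).
- by move=> c y y'; apply: kcob_lin.
- exact: kcob0.
- by move=> a y; apply: kcob_cpart.
- by move=> c j /rel[].
- by move=> c /rel[].
- by move=> c cV; rewrite -tq; apply: u0P.
- by rewrite -ds; apply: kall_trans.
- move=> a _ ha.
  (* At least [d.+1] variables lie off [V], each with [a c + r c >= q], so
     [|a| + \sum_c r c >= d.+1 * q]. One copy of [q] absorbs [C + \sum_c r c], and the other [d]
     copies dominate [u * d]. *)
  have h1 : (#|~: V| * q <= mdeg a + \sum_c r c)%N.
    rewrite -sum_nat_const mdegE -big_split /= [X in (_ <= X)%N](bigID (mem (~: V))) /=.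
    apply: leq_trans (leq_addr _ _); apply: leq_sum => c; rewrite inE; exact: ha.
  have h2 : (d.+1 * q <= #|~: V| * q)%N.
    by rewrite leq_mul2r cardsCs setCK card_ord ltn_subRL addnC -ltn_subRL ltV orbT.
  rewrite -(leq_add2r (\sum_c r c)%N); apply: leq_trans (leq_trans h2 h1).
  have h3 : (C + \sum_c r c <= q)%N.
    by rewrite (leq_trans _ (ltnW ltq)) // /e leqW // leq_add2r leq_addl.
  rewrite addnAC mulSn leq_add // mulnC leq_mul2l.
  by rewrite -tq leq_addl orbT.
(* A nonzero element of k[x_V] kills [z], hence lies in [P], against independence. *)
have : s0 *: z == 0 by apply/eqP/(Pg _ u); rewrite tq.
by rewrite -zP => /(iV _ sV) e0; rewrite e0 eqxx in s0nz.
Qed.
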